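(* Let $(\Omega,T)$ be a strictly ergodic Delone dynamical system of finite type in $\mathbb{R}^d$, let $A=(A_\omega)_{\omega\in\Omega}$ be a selfadjoint random operator of finite range on $(\Omega,T)$, and let $\rho^A$ be its integrated density of states. Then for $E\in\mathbb{R}$ the following are equivalent: (i) $E$ is a point of discontinuity of $\rho^A$, i.e. of the distribution function $\lambda\mapsto\rho^A((-\infty,\lambda])$; (ii) there exists a locally supported eigenfunction of $A_\omega$ with eigenvalue $E$ for one $\omega\in\Omega$; (iii) there exists a locally supported eigenfunction of $A_\omega$ with eigenvalue $E$ for all $\omega\in\Omega$.
   Context: Fix an integer $d\ge 1$. $B(p,r)$ denotes the closed Euclidean ball in $\mathbb{R}^d$ with center $p$ and radius $r$, and $|Q|$ denotes Lebesgue measure of $Q\subset\mathbb{R}^d$. Delone sets. A set $\omega\subset\mathbb{R}^d$ is a Delone set if there are $r(\omega),R(\omega)>0$ such that $\|x-y\|\ge 2r(\omega)$ for all distinct $x,y\in\omega$ and $B(x,R(\omega))\cap\omega\ne\emptyset$ for all $x\in\mathbb{R}^d$. Patterns. A pattern is a pair $(\Lambda,Q)$ with $Q\subset\mathbb{R}^d$ bounded and $\Lambda\subset Q$ finite. Two patterns $(\Lambda_1,Q_1)$, $(\Lambda_2,Q_2)$ are equivalent if there is $t\in\mathbb{R}^d$ with $\Lambda_1=\Lambda_2+t$ and $Q_1=Q_2+t$; $[(\Lambda,Q)]$ denotes the equivalence class (pattern class). For bounded $Q$ write $Q\wedge\omega=(\omega\cap Q,Q)$. For $s>0$ let $\mathcal{P}_B^s(\omega)=\{[B(p,s)\wedge\omega]:p\in\omega\}$.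 Natural topology. The set of closed subsets of $\mathbb{R}^d$ carries the natural topology: identify a closed set $F$ with the compact subset $F\cup\{\infty\}$ of the one-point compactification $\mathbb{R}^d\cup\{\infty\}\cong S^d$ and use the Hausdorff metric on compact subsets of $S^d$. This topology is compact, and the translation action $T_tG=G+t$ of $\mathbb{R}^d$ is continuous. Delone dynamical systems. A Delone dynamical system (DDS) $(\Omega,T)$ is a set $\Omega$ of Delone sets that is invariant under all translations $T_t$, $t\in\mathbb{R}^d$, and closed in the natural topology. It is of finite type (DDSF) if $\bigcup_{\omega\in\Omega}\mathcal{P}_B^s(\omega)$ is finite for every $s>0$. It is minimal if every orbit $\{T_t\omega:t\in\mathbb{R}^d\}$, $\omega\in\Omega$, is dense in $\Omega$; uniquely ergodic if it admits exactly one $T$-invariant measure up to normalization (i.e. exactly one $T$-invariant Borel probability measure); strictly ergodic if it is minimal and uniquely ergodic. Random operators. A random operator of finite range on a DDSF $(\Omega,T)$ is a family $(A_\omega)_{\omega\in\Omega}$ of bounded operators $A_\omega:\ell^2(\omega)\to\ell^2(\omega)$, with matrix elements $A_\omega(x,y)$, $x,y\in\omega$, for which there is a constant $r_A$ such that $A_\omega(x,y)=0$ whenever $\|x-y\|\ge r_A$, and $A_\omega(x,y)$ depends only on the pattern class of $(B(x,r_A)\cup B(y,r_A))\wedge\omega$ (for all $\omega\in\Omega$). It is selfadjoint if every $A_\omega$ is selfadjoint. Locally supported eigenfunctions. An eigenfunction $f\in\ell^2(\omega)$, $f\ne 0$, of $A_\omega$ is locally supported if its support is contained in a compact set $K\subset\mathbb{R}^d$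 (equivalently, its support is finite). Integrated density of states. For bounded $Q\subset\mathbb{R}^d$ (measurable, $|Q|>0$) let $A_\omega|_Q$ be the restriction of $A_\omega$ to $\ell^2(Q\cap\omega)$ (the finite matrix $(A_\omega(x,y))_{x,y\in Q\cap\omega}$), and let $\rho^{A_\omega}_Q$ be the measure on $\mathbb{R}$ with $\langle\rho^{A_\omega}_Q,\varphi\rangle=\frac{1}{|Q|}\mathrm{tr}(\varphi(A_\omega|_Q))$ for $\varphi\in C_b(\mathbb{R})$. A sequence $(Q_k)$ of such sets is a van Hove sequence if $|\partial^R Q_k|\,|Q_k|^{-1}\to 0$ for every $R\in(0,\infty)$, where $\partial^R Q$ is the set of points of $\mathbb{R}^d$ whose distance to the boundary of $Q$ is less than $R$. It is known that on a uniquely ergodic DDSF, for a selfadjoint random operator of finite range, the measures $\rho^{A_\omega}_{Q_k}$ converge in distribution, as $k\to\infty$, to a measure $\rho^A$ on $\mathbb{R}$ which does not depend on $\omega\in\Omega$ or on the van Hove sequence $(Q_k)$; $\rho^A$ is called the integrated density of states. *)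

(* Defs.v *)
From HB Require Import structures.
From mathcomp Require Import all_boot all_order all_algebra complex.
From mathcomp Require Import all_classical all_reals all_analysis.
From mathcomp Require Import measurable_realfun.
From mathcomp Require Import spectral ring lra.

Set Implicit Arguments.
Unset Strict Implicit.
Unset Printing Implicit Defensive.

Import Order.TTheory GRing.Theory Num.Theory.
Import numFieldNormedType.Exports.

Local Open Scope classical_set_scope.
Local Open Scope ring_scope.
Local Open Scope complex_scope.

Section Euclid.
Context {R : realType} {n : nat}.
Implicit Types x y z : 'rV[R]_n.

(* The library norm on ['rV_n] is the sup norm; it induces the same topology. *)
Definition sqnorm x : R := \sum_i x 0 i ^+ 2.
Definition enorm x : R := Num.sqrt (sqnorm x).

Definition shift (t : 'rV[R]_n) (A : set 'rV[R]_n) : set 'rV[R]_n :=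
  (fun x => x + t) @` A.

Definition cball x (r : R) : set 'rV[R]_n := [set y | enorm (x - y) <= r].

Lemma sqnorm_ge0 x : 0 <= sqnorm x.
Proof. by apply: sumr_ge0 => i _; exact: sqr_ge0. Qed.

Lemma enorm_ge0 x : 0 <= enorm x. Proof. exact: sqrtr_ge0. Qed.

Lemma sqr_enorm x : enorm x ^+ 2 = sqnorm x.
Proof. by rewrite sqr_sqrtr// sqnorm_ge0. Qed.

Lemma enormN x : enorm (- x) = enorm x.
Proof. by congr Num.sqrt; apply: eq_bigr => i _; rewrite mxE sqrrN. Qed.

Lemma enormC x y : enorm (x - y) = enorm (y - x).
Proof. by rewrite -enormN opprB. Qed.

Lemma sqnorm0 : sqnorm 0 = 0.
Proof. by rewrite /sqnorm big1// => i _; rewrite mxE expr0n. Qed.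

Lemma enorm0 : enorm 0 = 0. Proof. by rewrite /enorm sqnorm0 sqrtr0. Qed.

Lemma cauchy_schwarz x y :
  (\sum_i x 0 i * y 0 i) ^+ 2 <= sqnorm x * sqnorm y.
Proof.
suff : 0 <= \sum_i \sum_j (x 0 i * y 0 j - x 0 j * y 0 i) ^+ 2.
  have -> : \sum_i \sum_j (x 0 i * y 0 j - x 0 j * y 0 i) ^+ 2 =
      \sum_i \sum_j (x 0 i ^+ 2 * y 0 j ^+ 2 + x 0 j ^+ 2 * y 0 i ^+ 2
        - 2 * ((x 0 i * y 0 i) * (x 0 j * y 0 j))).
    by apply: eq_bigr => i _; apply: eq_bigr => j _; ring.
  under eq_bigr => i _ do rewrite sumrB big_split/= -!mulr_sumr -mulr_suml.
  rewrite sumrB big_split/= -!mulr_sumr -!mulr_suml.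
  rewrite -/(sqnorm x) -/(sqnorm y); nra.
by apply: sumr_ge0 => i _; apply: sumr_ge0 => j _; exact: sqr_ge0.
Qed.

Lemma sqnormD x y :
  sqnorm (x + y) = sqnorm x + 2 * (\sum_i x 0 i * y 0 i) + sqnorm y.
Proof.
rewrite /sqnorm mulr_sumr -!big_split/=; apply: eq_bigr => i _.
by rewrite mxE; ring.
Qed.

Lemma enormD x y : enorm (x + y) <= enorm x + enorm y.
Proof.
rewrite -(@ler_pXn2r _ 2)// ?nnegrE ?addr_ge0 ?enorm_ge0//.
rewrite sqr_enorm sqnormD sqrrD !sqr_enorm lerD2r lerD2l.
rewrite -[leRHS]mulr_natl ler_pM2l//.
apply: le_trans (ler_norm _) _.
rewrite -(@ler_pXn2r _ 2)// ?nnegrE ?mulr_ge0 ?enorm_ge0//.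
by rewrite real_normK ?num_real// exprMn !sqr_enorm cauchy_schwarz.
Qed.

Lemma enormB_le x y z : enorm (x - z) <= enorm (x - y) + enorm (y - z).
Proof. by rewrite (le_trans _ (enormD _ _))// addrA subrK. Qed.

End Euclid.

Section NaturalMetric.
Context {R : realType} {n : nat}.
Implicit Types (x y : 'rV[R]_n) (F G : set 'rV[R]_n).

(* Inverse stereographic projection from the north pole [(0, 1)]; it identifies
   the one-point compactification of R^n with the unit sphere of R^(n+1). *)
Definition stereo (p : one_point_compactification 'rV[R]_n) : 'rV[R]_(n + 1) :=
  if p is Some x then
    row_mx ((2 / (1 + sqnorm x)) *: x) ((sqnorm x - 1) / (1 + sqnorm x))%:M
  else row_mx 0 1%:M.

Definition sphere_image F : set 'rV[R]_(n + 1) :=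
  stereo @` (Some @` F `|` [set None]).

Definition within_eps m (A B : set 'rV[R]_m) (e : R) :=
  forall a, A a -> exists2 b, B b & enorm (a - b) <= e.

(* The infimum is taken over a nonempty set when [A] and [B] are nonempty and
   bounded, as are the images of compactified closed sets on the sphere. *)
Definition hausdorff_dist m (A B : set 'rV[R]_m) : R :=
  inf [set e | [/\ 0 <= e, within_eps A B e & within_eps B A e]].

Definition natural_dist F G : R :=
  hausdorff_dist (sphere_image F) (sphere_image G).

Lemma sqnorm_row_mx x (a : R) : sqnorm (row_mx x a%:M) = sqnorm x + a ^+ 2.
Proof.
rewrite /sqnorm big_split_ord/= big_ord1 row_mxEr mxE eqxx mulr1n.
by congr (_ + _); apply: eq_bigr => i _; rewrite row_mxEl.
Qed.

Lemma sqnormZ (a : R) x : sqnorm (a *: x) = a ^+ 2 * sqnorm x.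
Proof.
by rewrite /sqnorm mulr_sumr; apply: eq_bigr => i _; rewrite mxE exprMn.
Qed.

Lemma stereoB x y : sqnorm (stereo (Some x) - stereo (Some y)) =
  4 * sqnorm (x - y) / ((1 + sqnorm x) * (1 + sqnorm y)).
Proof.
rewrite /= opp_row_mx add_row_mx -raddfB/= sqnorm_row_mx.
have h (a b : R) : sqnorm (a *: x - b *: y) =
    a ^+ 2 * sqnorm x + 2 * (- (a * b) * \sum_i x 0 i * y 0 i)
      + b ^+ 2 * sqnorm y.
  rewrite sqnormD -scaleNr !sqnormZ sqrrN; congr (_ + _ * _ + _).
  by rewrite mulr_sumr; apply: eq_bigr => i _; rewrite !mxE; ring.
have := h 1 1; rewrite !scale1r => ->; rewrite h.
have := sqnorm_ge0 x; have := sqnorm_ge0 y.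
move: (sqnorm x) (sqnorm y) (\sum_i _) => s t p t0 s0.
by field; lra.
Qed.

Lemma stereo_inftyB x :
  sqnorm (stereo (Some x) - stereo None) = 4 / (1 + sqnorm x).
Proof.
rewrite /= opp_row_mx add_row_mx -raddfB/= sqnorm_row_mx oppr0 addr0 sqnormZ.
by have := sqnorm_ge0 x; move: (sqnorm x) => s s0; field; lra.
Qed.

Lemma enorm_stereo p : enorm (stereo p) = 1.
Proof.
rewrite -[RHS]sqrtr1; congr Num.sqrt; case: p => [x|] /=.
  rewrite sqnorm_row_mx sqnormZ.
  by have := sqnorm_ge0 x; move: (sqnorm x) => s s0; field; lra.
by rewrite sqnorm_row_mx sqnorm0 add0r expr1n.
Qed.

Lemma within_sphere F G (e : R) : 2 <= e ->
  within_eps (sphere_image F) (sphere_image G) e.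
Proof.
move=> e2 _ [p _ <-]; exists (stereo None); first by exists None => //; right.
by rewrite (le_trans _ e2)// (le_trans (enormD _ _))// enormN !enorm_stereo.
Qed.

Lemma hausdorff_has_inf F G : has_inf [set e : R | [/\ 0 <= e,
  within_eps (sphere_image F) (sphere_image G) e &
  within_eps (sphere_image G) (sphere_image F) e]].
Proof.
split; first by exists 2; split => //; exact: within_sphere.
by exists 0 => e [].
Qed.

Lemma natural_dist_lt F G (e : R) : natural_dist F G < e ->
  within_eps (sphere_image F) (sphere_image G) e.
Proof.
move=> FGe; have e0 : 0 < e - natural_dist F G by rewrite subr_gt0.
have [d [_ dF _]] := inf_adherent e0 (hausdorff_has_inf F G).
rewrite -/(hausdorff_dist _ _) -/(natural_dist _ _) subrKC => de a /dF[b Gb ab].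
by exists b => //; rewrite (le_trans ab)// ltW.
Qed.

Lemma natural_dist_sym F G : natural_dist F G = natural_dist G F.
Proof. by congr inf; apply/seteqP; split => e [? ? ?]; split. Qed.

Lemma natural_distxx F : natural_dist F F = 0.
Proof.
apply/eqP; rewrite eq_le; apply/andP; split.
  have h : within_eps (sphere_image F) (sphere_image F) 0.
    by move=> a Fa; exists a => //; rewrite subrr enorm0.
  by apply: ge_inf => //; exists 0 => e [].
by apply: lb_le_inf; [have [] := hausdorff_has_inf F F|move=> e []].
Qed.

Lemma within_trans m (A B C : set 'rV[R]_m) (d e : R) :
  within_eps A B d -> within_eps B C e -> within_eps A C (d + e).
Proof.
move=> AB BC a /AB[b /BC[c Cc bc] ab]; exists c => //.
by rewrite (le_trans (enormB_le _ b _))// lerD.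
Qed.

Lemma natural_dist_triangle G F H :
  natural_dist F H <= natural_dist F G + natural_dist G H.
Proof.
apply/ler_addgt0Pr => e e0.
have e2 : 0 < e / 2 by rewrite divr_gt0.
have [d [d0 FG GF] dl] := inf_adherent e2 (hausdorff_has_inf F G).
have [c [c0 GH HG] cl] := inf_adherent e2 (hausdorff_has_inf G H).
have /le_trans : natural_dist F H <= d + c.
  apply: ge_inf; first by exists 0 => z [].
  split; [exact: addr_ge0|exact: within_trans GH|].
  by rewrite addrC; exact: within_trans GF.
apply; move: dl cl; rewrite -!/(hausdorff_dist _ _) -!/(natural_dist _ _); lra.
Qed.

Lemma enorm_coord x i : `|x 0 i| <= enorm x.
Proof.
rewrite -(@ler_pXn2r _ 2)// ?nnegrE ?enorm_ge0//.
rewrite sqr_enorm real_normK ?num_real// /sqnorm (bigD1 i)//= lerDl.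
by apply: sumr_ge0 => j _; exact: sqr_ge0.
Qed.

Lemma enorm_closureP F x :
  (forall e, 0 < e -> exists2 y, F y & enorm (x - y) < e) -> closure F x.
Proof.
move=> h B /nbhs_ballP[e /= e0 eB].
have [y Fy xy] := h _ e0; exists y; split => //; apply: eB; split => // i j.
rewrite (ord1 i) /ball/= -[x 0 j - _]/((x 0 j) + (- _)).
by have := enorm_coord (x - y) j; rewrite !mxE => /le_lt_trans; apply.
Qed.

Lemma natural_dist_eq0_sub F G : closed G -> natural_dist F G = 0 -> F `<=` G.
Proof.
move=> cG FG0 x Fx; apply: cG; apply: enorm_closureP => e e0.
pose s := 1 + sqnorm x.
have s1 : 1 <= s by rewrite lerDl sqnorm_ge0.
pose d := Num.min (e / 2 / s) (s^-1).
have d0 : 0 < d by rewrite lt_min !divr_gt0 ?invr_gt0//; lra.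
have ds : d * s <= e / 2 by rewrite -ler_pdivlMr ?ge_min ?lexx//; lra.
have ds1 : d * s <= 1.
  by rewrite -ler_pdivlMr ?mul1r ?ge_min ?lexx ?orbT//; lra.
have FGd : natural_dist F G < d by rewrite FG0.
have Fx' : sphere_image F (stereo (Some x)).
  by exists (Some x) => //; left; exists x.
have [_ [p Gp <-]] := natural_dist_lt FGd Fx'.
rewrite -(@ler_pXn2r _ 2)// ?nnegrE ?enorm_ge0 ?(ltW d0)// sqr_enorm.
case: Gp => [[y Gy <-]|->].
  rewrite stereoB -/s => xyd; exists y => //.
  rewrite -(@ltr_pXn2r _ 2)// ?nnegrE ?enorm_ge0 ?(ltW e0)// sqr_enorm.
  move: xyd; rewrite ler_pdivrMr; last first.
    by rewrite mulr_gt0// ?ltr_pwDl ?sqnorm_ge0//; lra.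
  have : 1 + sqnorm y <= 2 * s + 2 * sqnorm (x - y).
    have : 0 <= sqnorm (2 *: x - y) by exact: sqnorm_ge0.
    rewrite [in X in X -> _]sqnormD [in X in X -> _]sqnormZ.
    rewrite sqnormD.
    have -> : \sum_i (2 *: x) 0 i * (- y) 0 i = 2 * \sum_i x 0 i * (- y) 0 i.
      by rewrite mulr_sumr; apply: eq_bigr => i _; rewrite !mxE; ring.
    have -> : sqnorm (- y) = sqnorm y.
      by rewrite -scaleN1r sqnormZ sqrrN expr1n mul1r.
    by rewrite /s; move: (\sum_i _) => p0; lra.
  have D0 := sqnorm_ge0 (x - y).
  have d2s : d ^+ 2 * s <= 1.
    apply: le_trans ds1; rewrite ler_pM2r; last lra.
    rewrite expr2 ger_pMr//.
    by rewrite /d ge_min; apply/orP; right; rewrite invf_le1//; lra.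
  move: D0; move: (sqnorm (x - y)) (sqnorm y) => D t D0 tD Dd.
  have h1 : 4 * D <= d ^+ 2 * s * (2 * s + 2 * D).
    rewrite (le_trans Dd)// mulrA ler_wpM2l// mulr_ge0 ?sqr_ge0//; lra.
  have h2 : d ^+ 2 * s * D <= D by rewrite ler_piMl.
  have h3 : D <= (d * s) ^+ 2 by nra.
  apply: (le_lt_trans h3).
  apply: (@le_lt_trans _ _ ((e / 2) ^+ 2)).
    by rewrite ler_pXn2r// ?nnegrE ?mulr_ge0// ?ltW//; lra.
  by rewrite ltr_pXn2r// ?nnegrE; lra.
rewrite stereo_inftyB -/s ler_pdivrMr; last lra.
move=> abs; exfalso; move: abs; apply/negP; rewrite -ltNge.
have : (d * s) ^+ 2 <= 1 by rewrite expr_le1// mulr_ge0//; lra.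
have : d ^+ 2 * s <= (d * s) ^+ 2.
  by rewrite exprMn ler_wpM2l ?sqr_ge0// expr2 ler_peMl//; lra.
lra.
Qed.

End NaturalMetric.

Record closed_set (R : realType) (n : nat) := ClosedSet {
  closed_set_val :> set 'rV[R]_n;
  closed_setP : closed closed_set_val }.

Section ClosedSets.
Context {R : realType} {n : nat}.
Local Notation closedR := (closed_set R n).
Implicit Types F G : closedR.

Lemma closed_set_eq F G : closed_set_val F = closed_set_val G -> F = G.
Proof.
by case: F G => [F cF] [G cG] /= FG; subst G; congr ClosedSet; exact: Prop_irrelevance.
Qed.

HB.instance Definition _ := gen_eqMixin closedR.
HB.instance Definition _ := gen_choiceMixin closedR.
HB.instance Definition _ := isPointed.Build closedR (ClosedSet closed0).

Let closed_dist F G : R := natural_dist F G.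

Let closed_dist_eq0 F G : closed_dist F G = 0 -> F = G.
Proof.
move=> FG0; apply: closed_set_eq; apply/seteqP; split.
  by apply: natural_dist_eq0_sub => //; exact: closed_setP.
apply: natural_dist_eq0_sub; first exact: closed_setP.
by rewrite natural_dist_sym.
Qed.

HB.instance Definition _ := isMetric.Build R closedR
  (fun F => natural_distxx F) closed_dist_eq0
  (fun F G => natural_dist_sym F G)
  (fun G F H => natural_dist_triangle G F H).

Lemma closed_shift (t : 'rV[R]_n) F : closed (shift t F).
Proof.
rewrite (_ : shift t F = (fun x : 'rV[R]_n => x - t) @^-1` F); last first.
  apply/seteqP; split => [_ [x Fx <-]|x Fx] /=; first by rewrite addrK.
  by exists (x - t) => //; rewrite subrK.
apply: closed_comp; last exact: closed_setP.
move=> x _; apply: (@cvgB _ _ _ (nbhs x) _ (fun x => x) (fun=> t)).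
  by move=> A.
exact: cvg_cst.
Qed.

Definition translate (t : 'rV[R]_n) F : closedR :=
  ClosedSet (@closed_shift t F).

End ClosedSets.

Section Lebesgue.
Context {R : realType}.

Section TupleCons.
Context {n : nat} (mu : {sigma_finite_measure set (n.-tuple R) -> \bar R}).

Let tcons (p : R * n.-tuple R) : n.+1.-tuple R := [tuple of p.1 :: p.2].

Let measurable_tcons : measurable_fun setT tcons.
Proof.
exact: (@measurable_cons _ _ (R * n.-tuple R)%type R fst n snd
  measurable_fst measurable_snd).
Qed.

Definition tcons_measure : set (n.+1.-tuple R) -> \bar R :=
  pushforward (@lebesgue_measure R \x mu)%E
    (fun p : R * n.-tuple R => [tuple of p.1 :: p.2]).

Let tcons0 : tcons_measure set0 = 0%E.
Proof. by rewrite /tcons_measure /pushforward preimage_set0 measure0. Qed.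

Let tcons_ge0 A : (0 <= tcons_measure A)%E.
Proof. exact: measure_ge0. Qed.

Let tcons_sigma_additive : semi_sigma_additive tcons_measure.
Proof.
move=> F mF tF mUF; rewrite /tcons_measure /pushforward preimage_bigcup.
apply: measure_semi_sigma_additive.
- by move=> k; rewrite -[X in measurable X]setTI; exact: measurable_tcons.
- apply/trivIsetP => /= i j _ _ ij; rewrite -preimage_setI.
  by move/trivIsetP : tF => /(_ _ _ _ _ ij) ->//; rewrite preimage_set0.
- by rewrite -preimage_bigcup -[X in measurable X]setTI; exact: measurable_tcons.
Qed.

HB.instance Definition _ := isMeasure.Build _ _ _ tcons_measure
  tcons0 tcons_ge0 tcons_sigma_additive.

Let tcons_sigma_finite : sigma_finite setT tcons_measure.
Proof.
have [F FT Foo] : sigma_finite setT (@lebesgue_measure R \x mu)%E.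
  have /sigma_finiteP[F [TF ndF Foo]] := sigma_finiteT (@lebesgue_measure R).
  have /sigma_finiteP[G [TG ndG Goo]] := sigma_finiteT mu.
  exists (fun k => F k `*` G k).
    rewrite -setXTT TF TG predeqE => -[x y]; split.
      move=> [/= [k _ Fkx] [l _ Gly]]; exists (maxn k l) => //; split.
      - by move: x Fkx; exact/subsetPset/ndF/leq_maxl.
      - by move: y Gly; exact/subsetPset/ndG/leq_maxr.
    by move=> [k _ []/= ? ?]; split; exists k.
  move=> k; have [? ?] := Foo k; have [? ?] := Goo k.
  split; first exact: measurableX.
  by rewrite product_measure1E// lte_mul_pinfty// ge0_fin_numE.
have mtl : measurable_fun setT (fun t : n.+1.-tuple R =>
    (thead t, [tuple of behead t] : n.-tuple R)).
  by apply: measurable_fun_pair => /=;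
    [exact: measurable_tnth|exact: measurable_behead].
exists (fun k => (fun t : n.+1.-tuple R =>
    (thead t, [tuple of behead t] : n.-tuple R)) @^-1` F k).
  by rewrite -preimage_bigcup -FT preimage_setT.
move=> k; have [mF Fk] := Foo k; split.
  by rewrite -[X in measurable X]setTI; exact: mtl.
rewrite /tcons_measure /pushforward -comp_preimage.
rewrite (_ : _ \o _ = id) ?preimage_id//.
by apply/funext => -[x t] /=; rewrite theadE; congr pair; exact/val_inj.
Qed.

HB.instance Definition _ := Measure_isSigmaFinite.Build _ _ _ tcons_measure
  tcons_sigma_finite.

End TupleCons.

Fixpoint lebesgue_tuple n : {sigma_finite_measure set (n.-tuple R) -> \bar R} :=
  match n with
  | 0%N => \d_([tuple] : 0.-tuple R)
  | m.+1 => tcons_measure (lebesgue_tuple m)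
  end.

(* The Borel sigma-algebra of R^n. *)
Definition borel_rV n := g_sigma_algebraType (@open 'rV[R]_n).

Definition row_of_tuple n (t : n.-tuple R) : borel_rV n := \row_i tnth t i.

Lemma measurable_row_of_tuple n : measurable_fun setT (@row_of_tuple n).
Proof.
apply: (measurability (@open 'rV[R]_n : set (set (borel_rV n)))) => //.
move=> _ [U oU <-]; rewrite setTI.
pose box (p : 'rV[rat]_n * rat) : set (n.-tuple R) := \bigcap_i
  ((fun t : n.-tuple R => tnth t i) @^-1` ball (ratr (p.1 0 i) : R) (ratr p.2)).
have mbox p : measurable (box p).
  apply: fin_bigcap_measurable => [|i _]; first exact: finite_finset.
  rewrite -[X in measurable X]setTI; apply: measurable_tnth => //.
  exact: measurable_ball.
rewrite (_ : _ @^-1` _ = \bigcup_p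
  (if `[< box p `<=` @row_of_tuple n @^-1` U >] then box p else set0)).
  apply: countable_bigcupT_measurable => // p; case: ifP => // _.
apply/seteqP; split=> [t Ut|t [p _]]; last first.
  by case: asboolP => // /[apply].
have /nbhs_ballP[e /= e0 eU] : nbhs (row_of_tuple t : 'rV[R]_n) U.
  exact: open_nbhs_nbhs.
have [r r0 re] : exists2 r : rat, 0 < (ratr r : R) & ratr r < e / 2.
  have /rat_in_itvoo[r] : 0 < e / 2 by rewrite divr_gt0.
  by rewrite in_itv/= => /andP[]; exists r.
have q i : {q : rat | `|tnth t i - ratr q| < ratr r :> R}.
  apply: cid; have /rat_in_itvoo[q] : tnth t i - ratr r < tnth t i + ratr r.
    by rewrite ltrBlDr -addrA ltrDl addr_gt0.
  by rewrite in_itv/= -ltr_distlC => tq; exists q.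
exists (\row_i sval (q i), r) => //; case: asboolP => [_|].
  by move=> i _ /=; rewrite /ball/= mxE distrC; exact: svalP (q i).
case=> s sbox; apply: eU; split => // i j; rewrite !mxE.
have := sbox j Logic.I; rewrite /ball /= !mxE => h1; have h2 := svalP (q j).
rewrite -[X in X - _](subrK (ratr (sval (q j)))) -addrA.
by rewrite (le_lt_trans (ler_normD _ _))// (splitr e) ltrD// (lt_trans _ re).
Qed.

Definition lebesgue_rV n : set (borel_rV n) -> \bar R :=
  pushforward (lebesgue_tuple n) (@row_of_tuple n).

Section LebesgueMeasure.
Context {n : nat}.

Let leb0 : @lebesgue_rV n set0 = 0%E.
Proof. by rewrite /lebesgue_rV /pushforward preimage_set0 measure0. Qed.

Let leb_ge0 A : (0 <= @lebesgue_rV n A)%E.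
Proof. by rewrite /lebesgue_rV /pushforward measure_ge0. Qed.

Let leb_sigma_additive : semi_sigma_additive (@lebesgue_rV n).
Proof.
move=> F mF tF mUF; rewrite /lebesgue_rV /pushforward preimage_bigcup.
have mr A : measurable A -> measurable (@row_of_tuple n @^-1` A).
  by move=> mA; rewrite -[X in measurable X]setTI; exact: measurable_row_of_tuple.
apply: measure_semi_sigma_additive.
- by move=> k; exact: mr.
- apply/trivIsetP => /= i j _ _ ij; rewrite -preimage_setI.
  by move/trivIsetP : tF => /(_ _ _ _ _ ij) ->//; rewrite preimage_set0.
- by rewrite -preimage_bigcup; exact: mr.
Qed.

HB.instance Definition _ := isMeasure.Build _ _ _ (@lebesgue_rV n)
  leb0 leb_ge0 leb_sigma_additive.

End LebesgueMeasure.

End Lebesgue.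

Section DeloneSystems.
Context {R : realType} {d : nat}.
Local Notation V := 'rV[R]_d.

Definition delone (w : set V) := exists r s : R,
  [/\ 0 < r, 0 < s,
      forall x y, w x -> w y -> x <> y -> 2 * r <= enorm (x - y) &
      forall x, (cball x s `&` w) !=set0].

Definition pattern := (set V * set V)%type.

Definition shift_pattern (t : V) (p : pattern) : pattern :=
  (shift t p.1, shift t p.2).

Definition pattern_equiv (p q : pattern) := exists t, p = shift_pattern t q.

Definition pattern_class (p : pattern) : set pattern :=
  [set q | pattern_equiv q p].

Definition wedge (Q w : set V) : pattern := (w `&` Q, Q).

Definition ball_patterns (s : R) (w : set V) : set (set pattern) :=
  [set pattern_class (wedge (cball p s) w) | p in w].

Record is_dds (Omega : set (closed_set R d)) : Prop := IsDDS {
  dds_delone : forall w, Omega w -> delone w;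
  dds_invariant : forall t w, Omega w -> Omega (translate t w);
  dds_closed : closed Omega }.

Record is_ddsf (Omega : set (closed_set R d)) : Prop := IsDDSF {
  ddsf_dds :> is_dds Omega;
  ddsf_finite : forall s, 0 < s ->
    finite_set (\bigcup_(w in Omega) ball_patterns s w) }.

Definition orbit (w : closed_set R d) : set (closed_set R d) :=
  range (fun t => translate t w).

Definition minimal (Omega : set (closed_set R d)) :=
  forall w, Omega w -> Omega `<=` closure (orbit w).

Definition borel_closed_set := g_sigma_algebraType (@open (closed_set R d)).

(* A Borel probability measure on the closed set [Omega] is the same as a Borel
   probability measure on the ambient space giving [Omega] full mass. *)
Definition invariant_probability (Omega : set (closed_set R d))
    (mu : probability borel_closed_set R) :=
  mu Omega = 1%E /\
  forall t (B : set borel_closed_set), measurable B ->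
    mu (translate t @^-1` B) = mu B.

Definition uniquely_ergodic (Omega : set (closed_set R d)) :=
  exists2 mu, invariant_probability Omega mu &
    forall nu, invariant_probability Omega nu ->
      forall B : set borel_closed_set, measurable B -> nu B = mu B.

Definition strictly_ergodic (Omega : set (closed_set R d)) :=
  minimal Omega /\ uniquely_ergodic Omega.

End DeloneSystems.

Section RandomOperators.
Context {R : realType} {d : nat}.
Local Notation V := 'rV[R]_d.
Local Notation C := R[i].
Implicit Types (w : set V) (f g : V -> C) (Omega : set (closed_set R d)).

Definition sqmod (z : C) : R := complex.Re z ^+ 2 + complex.Im z ^+ 2.

Definition ell2_sqnorm w f : \bar R := \esum_(x in w) (sqmod (f x))%:E.

(* Elements of l^2(w) are represented by their extensions by zero to R^d. *)
Definition ell2 w : set (V -> C) :=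
  [set f | (forall x, ~ w x -> f x = 0) /\ (ell2_sqnorm w f < +oo)%E].

Definition ell2_norm w f : R := Num.sqrt (fine (ell2_sqnorm w f)).

Definition real_sum w (g : V -> R) : R :=
  fine (\esum_(x in w) (Num.max (g x) 0)%:E)
  - fine (\esum_(x in w) (Num.max (- g x) 0)%:E).

Definition ell2_dot w f g : C :=
  let h x := conjc (f x) * g x in
  Complex (real_sum w (fun x => complex.Re (h x))) (real_sum w (fun x => complex.Im (h x))).

(* Only the values on l^2(w) of an operator on l^2(w) are relevant. *)
Definition operator := (V -> C) -> (V -> C).

Record bounded_operator w (T : operator) : Prop := BoundedOperator {
  operator_ell2 : forall f, ell2 w f -> ell2 w (T f);
  operator_linear : forall (a : C) f g, ell2 w f -> ell2 w g ->
    T (fun x => a * f x + g x) = (fun x => a * T f x + T g x);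
  operator_bounded : exists M : R, forall f, ell2 w f ->
    ell2_norm w (T f) <= M * ell2_norm w f }.

Definition selfadjoint_operator w (T : operator) :=
  forall f g, ell2 w f -> ell2 w g -> ell2_dot w f (T g) = ell2_dot w (T f) g.

Definition basis_vector (y : V) : V -> C := fun z => (z == y)%:R.

Definition matrix_element (T : operator) (x y : V) : C :=
  T (basis_vector y) x.

Definition pair_pattern (r : R) w (x y : V) : pattern :=
  wedge (cball x r `|` cball y r) w.

(* Equality of pattern classes is understood for patterns marked at the ordered
   pair [(x, y)]: the translation matching the two patterns also matches the two
   pairs. *)
Definition finite_range Omega (A : closed_set R d -> operator) (r : R) :=
  (forall w : closed_set R d, Omega w ->
    forall x y, closed_set_val w x -> closed_set_val w y ->
    r <= enorm (x - y) -> matrix_element (A w) x y = 0) /\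
  (forall w w' : closed_set R d, Omega w -> Omega w' ->
    forall x y t, closed_set_val w x -> closed_set_val w y ->
    closed_set_val w' (x + t) -> closed_set_val w' (y + t) ->
    pair_pattern r w' (x + t) (y + t) = shift_pattern t (pair_pattern r w x y) ->
    matrix_element (A w') (x + t) (y + t) = matrix_element (A w) x y).

Record selfadjoint_random_operator Omega (A : closed_set R d -> operator) :
    Prop := SelfadjointRandomOperator {
  random_bounded : forall w : closed_set R d, Omega w -> bounded_operator w (A w);
  random_finite_range : exists r : R, finite_range Omega A r;
  random_selfadjoint : forall w : closed_set R d, Omega w -> selfadjoint_operator w (A w) }.

Definition locally_supported_eigenfunction w (T : operator) (E : R) f :=
  [/\ ell2 w f, f <> (fun=> 0), T f = (fun x => E%:C * f x) &
      exists2 K : set V, compact K & forall x, f x <> 0 -> K x].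

(* Spectral functional calculus of a Hermitian matrix; taking real parts of the
   (real) eigenvalues only serves typing. *)
Definition mx_calculus n (phi : R -> R) (M : 'M[C]_n) : 'M[C]_n :=
  invmx (spectralmx M) *m
  diag_mx (map_mx (fun z => (phi (complex.Re z))%:C) (spectral_diag M)) *m
  spectralmx M.

Definition restriction (T : operator) (s : seq V) : 'M[C]_(size s) :=
  \matrix_(i, j) matrix_element T s`_i s`_j.

Definition volume (Q : set V) : R := fine (@lebesgue_rV R d Q).

(* [phi |-> <rho_Q, phi>] for the operator [T] on l^2(w). *)
Definition local_dos w (T : operator) (Q : set V) (phi : R -> R) : R :=
  (volume Q)^-1 *
  complex.Re (\tr (mx_calculus phi (restriction T (finmap.enum_fset (fset_set (Q `&` w)))))).

Definition boundary (Q : set V) : set V := closure Q `\` interior Q.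

(* The distance from [x] to a nonempty set is less than [r] iff some point of the
   set is at distance less than [r] from [x]. *)
Definition tube (r : R) (Q : set V) : set V :=
  [set x | exists2 y, boundary Q y & enorm (x - y) < r].

Record van_hove (Q : nat -> set V) : Prop := VanHove {
  van_hove_bounded : forall k, bounded_set (Q k);
  van_hove_measurable : forall k, measurable (Q k : set (@borel_rV R d));
  van_hove_pos : forall k, 0 < volume (Q k);
  van_hove_tube : forall r, 0 < r ->
    volume (tube r (Q k)) / volume (Q k) @[k --> \oo] --> (0 : R) }.

Definition integrated_density_of_states Omega (A : closed_set R d -> operator)
    (rho : {finite_measure set R -> \bar R}) :=
  forall w : closed_set R d, Omega w -> forall Q, van_hove Q ->
  forall phi : R -> R, continuous phi -> (exists M, forall x, `|phi x| <= M) ->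
  local_dos w (A w) (Q k) phi @[k --> \oo] --> Rintegral rho setT phi.

Definition distribution_function (rho : {finite_measure set R -> \bar R}) :
    R -> R :=
  fun l => fine (rho `]-oo, l]%classic).

End RandomOperators.

(* Main.v *)
Require Import Defs.
From mathcomp Require Import all_boot all_order all_algebra complex.
From mathcomp Require Import all_classical all_reals all_analysis.
From mathcomp Require Import measurable_realfun spectral ring lra zify.

(* Only the nonemptiness of [Omega] is extracted from unique ergodicity; the rest
   uses minimality and finite local complexity, i.e. that only finitely many local
   configurations of a given radius occur, up to translation.

   By minimality every configuration of [w] recurs exactly in every [w'] of
   [Omega], and recurs in [w] itself with bounded gaps. Hence a locally supported
   eigenfunction on one [w] gives one on all of them, and its copies in the
   [k^d] blocks of side [L] of a cube of side [k L] are independent, so that [E]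
   is an eigenvalue of the restricted matrix of multiplicity at least [k^d], and
   [rho] has mass at least [L^-d] in every neighbourhood of [E].

   Conversely, suppose that [A_w] has no locally supported eigenfunction for [E].
   Fix a block side [L]. Finite local complexity gives [c > 0] such that
   [c |g|^2 <= |(A_w - E) g|^2] for all [g] supported in a block. If the spectral
   subspace of the restricted matrix for a small interval around [E] had dimension
   larger than the number of points close to the boundaries of blocks, it would
   contain some [f <> 0] vanishing at these points; [A_w - E] then acts blockwise
   on [f], which contradicts the lower bound. So [rho] has mass [O(1/L)] near [E]
   for every [L]. *)

Set Implicit Arguments.
Unset Strict Implicit.
Unset Printing Implicit Defensive.

Import Order.TTheory GRing.Theory Num.Theory.
Import numFieldNormedType.Exports.

Local Open Scope classical_set_scope.
Local Open Scope ring_scope.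

(** * Local configurations and the natural topology *)

Section Geometry.
Context {R : realType} {d : nat}.
Local Notation V := 'rV[R]_d.
Local Notation shift := Defs.shift.
Implicit Types (a x y p q t u v : V) (w : set V).

Lemma enormZ (a : R) x : enorm (a *: x) = `|a| * enorm x.
Proof. by rewrite /enorm sqnormZ sqrtrM ?sqr_ge0// sqrtr_sqr. Qed.

Lemma enorm_eq0 x : enorm x = 0 -> x = 0.
Proof.
move=> x0; apply/rowP => i; apply/eqP; rewrite mxE -normr_le0 -x0.
exact: enorm_coord.
Qed.

(** The sum of the absolute values of the coordinates dominates [enorm x]. The factor [d], cruder
    than its square root, suffices for comparison with the sup-norm balls of the topology. *)
Lemma enorm_le_coord (c : R) x :
  (forall i, `|x 0 i| <= c) -> enorm x <= d%:R * c.
Proof.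
move=> xc; have -> : d%:R * c = \sum_(i < d) c.
  by rewrite sumr_const card_ord mulr_natl.
apply: (@le_trans _ _ (\sum_i `|x 0 i|)); last exact: ler_sum.
have s0 : 0 <= \sum_i `|x 0 i| by apply: sumr_ge0.
rewrite -(@ler_pXn2r _ 2)// ?nnegrE ?enorm_ge0// sqr_enorm.
rewrite expr2 mulr_suml; apply: ler_sum => i _.
rewrite -real_normK ?num_real// expr2 ler_wpM2l//.
by rewrite (bigD1 i)//= lerDl sumr_ge0.
Qed.

Lemma cball_inj p q (s : R) : 0 <= s -> cball p s = cball q s -> p = q.
Proof.
move=> s0 pq; apply: contrapT => npq.
have n0 : 0 < enorm (p - q).
  rewrite lt0r enorm_ge0 andbT; apply/eqP => /enorm_eq0/eqP.
  by rewrite subr_eq0 => /eqP.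
(* The point of the first ball opposite to [q]; its distance from [q] is [s + enorm (p - q)]. *)
have : cball p s (p + (s / enorm (p - q)) *: (p - q)).
  rewrite /cball/= opprD addNKr enormN enormZ ger0_norm ?divr_ge0 ?enorm_ge0//.
  by rewrite divfK ?gt_eqF.
rewrite pq /cball/= enormC addrAC -{1}[p - q]scale1r -scalerDl enormZ.
rewrite ger0_norm ?addr_ge0 ?divr_ge0 ?enorm_ge0// mulrDl mul1r divfK ?gt_eqF//.
lra.
Qed.

Lemma shift_cball t p (s : R) : shift t (cball p s) = cball (p + t) s.
Proof.
apply/seteqP; split => [_ [x px <-]|x px]; rewrite /cball/=.
  by rewrite opprD addrACA subrr addr0.
by exists (x - t); rewrite ?subrK// /cball/= opprB addrA.
Qed.

Lemma shiftE t w x : shift t w x = w (x - t).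
Proof.
apply/propext; split => [[y wy <-]|wx]; first by rewrite addrK.
by exists (x - t) => //; rewrite subrK.
Qed.

Lemma closed_cball p (s : R) : closed (cball p s).
Proof.
move=> y yc; rewrite /cball/=; apply/ler_addgt0Pr => e e0.
(* Neighbourhoods are given by sup-norm balls, hence the division; [d.+1] keeps the divisor nonzero
   for [d = 0]. *)
pose e' := e / d.+1%:R; have e'0 : 0 < e' by rewrite divr_gt0.
have [z [pz yz]] := yc _ (nbhsx_ballx y e' e'0).
rewrite (le_trans (enormB_le p z y))// lerD//.
apply: (@le_trans _ _ (d%:R * e')).
  apply: enorm_le_coord => i; rewrite !mxE distrC.
  by case: yz => _ /(_ 0 i); rewrite /ball/= => /ltW.
by rewrite /e' mulrCA ler_piMr ?(ltW e0)// ler_pdivrMr// mul1r ler_nat.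
Qed.

Lemma coord_le_norm x i : `|x 0 i| <= `|x|.
Proof.
by rewrite [leRHS]/Num.norm/= mx_normrE; apply: (@le_bigmax_cond _ _ _ _ (0, i)
  xpredT (fun k => `|x k.1 k.2|)).
Qed.

Lemma norm_le_coord x (c : R) : 0 <= c -> (forall i, `|x 0 i| <= c) -> `|x| <= c.
Proof.
move=> c0 xc; rewrite [leLHS]/Num.norm/= mx_normrE; apply: bigmax_le => //.
by case=> k i _ /=; rewrite (ord1 k).
Qed.

Lemma compact_cball p (s : R) : compact (cball p s).
Proof.
apply: bounded_closed_compact; last exact: closed_cball.
exists (enorm p + s); split; first exact: num_real.
move=> c sc x px /=; apply: norm_le_coord => [|i].
  by apply: ltW; apply: le_lt_trans sc; rewrite addr_ge0 ?enorm_ge0// (le_trans (enorm_ge0 _) px).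
rewrite (le_trans (enorm_coord _ _))// (le_trans _ (ltW sc))//.
by have := enormB_le x p 0; rewrite !subr0 enormC /cball/= in px *; lra.
Qed.

Lemma compact_sub_cball (K : set V) : compact K -> exists s : R, K `<=` cball 0 s.
Proof.
move=> /compact_bounded[M [_ MK]]; exists (d%:R * (M + 1)) => x Kx.
rewrite /cball/= sub0r enormN; apply: enorm_le_coord => i.
by rewrite (le_trans (coord_le_norm _ _))// (MK (M + 1))// ltrDl.
Qed.

(** Coordinates are centered at [p], so that translation equivalence of centered ball patterns
    becomes plain equality of sets. *)
Definition loc (s : R) w p : set V := [set v | enorm v <= s /\ w (p + v)].

Lemma loc_mono (s s' : R) w w' p p' : s' <= s ->
  loc s w p = loc s w' p' -> loc s' w p = loc s' w' p'.
Proof.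
move=> ss h; apply/seteqP; split=> v [vs wv]; split=> //.
  by have : loc s w p v by [split => //; exact: le_trans ss]; rewrite h => -[].
by have : loc s w' p' v by [split => //; exact: le_trans ss]; rewrite -h => -[].
Qed.

Lemma loc_shift (s : R) w p t : loc s (shift t w) (p + t) = loc s w p.
Proof.
by apply/seteqP; split => v [vs]; rewrite /loc/= shiftE addrAC addrK.
Qed.

Lemma pattern_class_inj (P Q : @pattern R d) :
  pattern_class P = pattern_class Q -> pattern_equiv P Q.
Proof.
move=> PQ; suff : pattern_class P P by rewrite PQ.
have shift0 (B : set V) : shift 0 B = B.
  by apply/seteqP; split=> x; rewrite shiftE subr0.
by exists 0; case: P {PQ} => P1 P2; rewrite /shift_pattern/= !shift0.
Qed.

(** The translation matching the patterns carries one ball onto the other, so by [cball_inj] it is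
    [p - q]. *)
Lemma loc_of_class (s : R) w w' p q : 0 <= s ->
  pattern_class (wedge (cball p s) w) = pattern_class (wedge (cball q s) w') ->
  loc s w p = loc s w' q.
Proof.
move=> s0 /pattern_class_inj[t]; rewrite /wedge /shift_pattern/= shift_cball.
move=> [ww /(cball_inj s0) pq]; apply/seteqP; split => v [vs wv]; split => //.
  have : (w `&` cball p s) (p + v).
    by split => //; rewrite /cball/= opprD addNKr enormN.
  by rewrite ww shiftE pq addrAC addrK => -[].
have : shift t (w' `&` cball q s) (q + v + t).
  rewrite shiftE addrK; split => //.
  by rewrite /cball/= opprD addNKr enormN.
by rewrite -ww pq addrAC => -[].
Qed.

(** By [loc_of_class] a pattern class determines [loc], so these sets lie in the image of a finite
    set under the choice [h]. *)
Lemma finite_locs (Omega : set (closed_set R d)) (s : R) : is_ddsf Omega ->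
  0 < s -> finite_set [set L | exists w : closed_set R d, Omega w /\
                         exists2 p, closed_set_val w p & L = loc s w p].
Proof.
move=> Om s0; have fin := ddsf_finite Om s0.
pose h (P : set pattern) : set V :=
  xget set0 [set L | exists w : closed_set R d, Omega w /\
    exists2 p, closed_set_val w p &
      P = pattern_class (wedge (cball p s) w) /\ L = loc s w p].
apply: sub_finite_set (finite_image h fin) => L [w [Ow [p wp ->]]].
exists (pattern_class (wedge (cball p s) w)); first by exists w => //; exists p.
rewrite /h; case: xgetP => [L' _ [w' [Ow' [p' wp' [PP ->]]]]|/(_ (loc s w p))].
  by apply: loc_of_class; rewrite ?ltW.
by case; exists w; split => //; exists p.
Qed.

Definition separated (r : R) w :=
  forall x y, w x -> w y -> x <> y -> 2 * r <= enorm (x - y).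

(** [Num.truncn] sends negative numbers to 0, so this is a cell index only where
    [a 0 i <= x 0 i]. *)
Definition grid a (h : R) x (i : 'I_d) : nat :=
  Num.truncn ((x 0 i - a 0 i) / h).

Lemma grid_inj (r : R) w a x y : 0 < r -> separated r w -> w x -> w y ->
  (forall i, a 0 i <= x 0 i) -> (forall i, a 0 i <= y 0 i) ->
  (forall i, grid a (r / d.+1%:R) x i = grid a (r / d.+1%:R) y i) -> x = y.
Proof.
move=> r0 sep wx wy ax ay xy; apply: contrapT => nxy.
have := sep _ _ wx wy nxy; apply/negP; rewrite -ltNge.
have h0 : 0 < r / d.+1%:R by rewrite divr_gt0.
have cell (z : V) i : a 0 i <= z 0 i -> (grid a (r / d.+1%:R) z i)%:R * (r / d.+1%:R) <=
    z 0 i - a 0 i < (grid a (r / d.+1%:R) z i).+1%:R * (r / d.+1%:R).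
  move=> az; rewrite -ler_pdivlMr// -ltr_pdivrMr//.
  by apply: truncn_itv; rewrite divr_ge0 ?subr_ge0// ltW.
(* Coordinates in a common cell differ by at most the mesh, so the distance is at most
   [d * (r / d.+1) <= r], below [2 * r]. *)
apply: (@le_lt_trans _ _ (d%:R * (r / d.+1%:R))).
  apply: enorm_le_coord => i; rewrite !mxE ler_norml.
  have /andP[] := cell _ _ (ax i); have /andP[] := cell _ _ (ay i).
  rewrite xy -!natr1 mulrDl; lra.
rewrite mulrCA; apply: (@le_lt_trans _ _ r); last lra.
rewrite ler_piMr ?(ltW r0)// ler_pdivrMr// mul1r ler_nat.
exact: leqnSn.
Qed.

Lemma finite_separated (r s : R) w p : 0 < r -> separated r w ->
  finite_set (w `&` cball p s).
Proof.
move=> r0 sep; have h0 : 0 < r / d.+1%:R by rewrite divr_gt0.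
pose a : V := \row_i (p 0 i - s); pose n := Num.truncn (2 * s / (r / d.+1%:R)).
pose g x : {ffun 'I_d -> 'I_n.+1} := [ffun i => inord (grid a (r / d.+1%:R) x i)].
have [aw gr] : (forall x, (w `&` cball p s) x -> forall i, a 0 i <= x 0 i) /\
    (forall x, (w `&` cball p s) x -> forall i, (grid a (r / d.+1%:R) x i < n.+1)%N).
  have co x i : (w `&` cball p s) x -> - s <= x 0 i - p 0 i <= s.
    move=> [_ px]; rewrite -ler_norml distrC.
    by have := enorm_coord (p - x) i; rewrite !mxE => /le_trans; apply.
  split=> x wx i; have /andP[] := co _ i wx; rewrite /grid !mxE; first lra.
  rewrite ltnS => h1 h2; apply: le_truncn.
  by rewrite ler_pM2r ?invr_gt0//; lra.
have : finite_set (g @` (w `&` cball p s)) by exact: finite_finset.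
have : set_inj (w `&` cball p s) g.
  move=> x y /set_mem wx /set_mem wy /ffunP gxy.
  apply: (grid_inj r0 sep) (wx.1) (wy.1) (aw _ wx) (aw _ wy) _ => i.
  by have := congr1 (@nat_of_ord _) (gxy i); rewrite !ffunE !inordK ?gr.
by move=> /inj_card_eq/eq_finite_set ->.
Qed.

(* The bound on [e] keeps the point of [G] matched with [x] away from infinity. *)
Lemma natural_dist_near (F G : set V) x (e : R) :
  natural_dist F G < e -> e ^+ 2 * (1 + sqnorm x) <= 1 -> F x ->
  exists2 y, G y & enorm (x - y) <= e * (1 + sqnorm x).
Proof.
move=> FGe es Fx; set s := 1 + sqnorm x in es *.
have s1 : 1 <= s by rewrite lerDl sqnorm_ge0.
have Fx' : sphere_image F (stereo (Some x)).
  by exists (Some x) => //; left; exists x.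
have [_ [p Gp <-]] := natural_dist_lt FGe Fx'.
move=> pe; have e0 : 0 <= e by apply: le_trans pe; exact: enorm_ge0.
move: pe; rewrite -(@ler_pXn2r _ 2)// ?nnegrE ?enorm_ge0// sqr_enorm.
case: Gp => [[y Gy <-]|->]; last first.
  by rewrite stereo_inftyB -/s ler_pdivrMr; lra.
rewrite stereoB -/s => xyd; exists y => //.
rewrite -(@ler_pXn2r _ 2)// ?nnegrE ?enorm_ge0 ?mulr_ge0//; last lra.
rewrite sqr_enorm; move: xyd; rewrite ler_pdivrMr; last first.
  by rewrite mulr_gt0// ?ltr_pwDl ?sqnorm_ge0//; lra.
(* This is [0 <= sqnorm (2 *: x - y)] expanded. It bounds the factor [1 + sqnorm y] of the chordal
   distance, leaving an inequality for [D = sqnorm (x - y)], whose right-hand term in [D] is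
   absorbed by means of [es]. *)
have : 1 + sqnorm y <= 2 * s + 2 * sqnorm (x - y).
  have : 0 <= sqnorm (2 *: x - y) by exact: sqnorm_ge0.
  rewrite [in X in X -> _]sqnormD [in X in X -> _]sqnormZ sqnormD.
  have -> : \sum_i (2 *: x) 0 i * (- y) 0 i = 2 * \sum_i x 0 i * (- y) 0 i.
    by rewrite mulr_sumr; apply: eq_bigr => i _; rewrite !mxE; ring.
  have -> : sqnorm (- y) = sqnorm y.
    by rewrite -scaleN1r sqnormZ sqrrN expr1n mul1r.
  by rewrite /s; move: (\sum_i _) => p0; lra.
have := sqnorm_ge0 (x - y); move: es; rewrite exprMn.
move: (sqnorm (x - y)) (sqnorm y) => D t es D0 tD Dd.
have es0 : 0 <= e ^+ 2 * s by rewrite mulr_ge0 ?sqr_ge0//; lra.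
have h1 : 4 * D <= e ^+ 2 * s * (2 * s + 2 * D).
  by rewrite (le_trans Dd)// mulrA ler_wpM2l.
have h2 : e ^+ 2 * s * D <= D by rewrite ler_piMl.
lra.
Qed.

(** Points of norm at most [m] are common to [F] and [G]; any other point is at chordal distance at
    most [2 / m] from infinity, which lies in both images. *)
Lemma natural_dist_loc (F G : set V) (m : R) : 0 < m ->
  F `&` cball 0 m = G `&` cball 0 m -> natural_dist F G <= 2 / m.
Proof.
move=> m0 FG; have h (A B : set V) : A `&` cball 0 m = B `&` cball 0 m ->
    within_eps (sphere_image A) (sphere_image B) (2 / m).
  move=> AB _ [p Ap <-].
  have inf0 : sphere_image B (stereo None) by exists None => //; right.
  case: Ap => [[x Ax <-]|->]; last first.
    by exists (stereo None) => //; rewrite subrr enorm0 divr_ge0// ltW.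
  have [xm|mx] := leP (enorm x) m.
    exists (stereo (Some x)); last by rewrite subrr enorm0 divr_ge0// ltW.
    exists (Some x) => //; left; exists x => //.
    have : (A `&` cball 0 m) x by split => //; rewrite /cball/= sub0r enormN.
    by rewrite AB => -[].
  exists (stereo None) => //.
  rewrite -(@ler_pXn2r _ 2)// ?nnegrE ?enorm_ge0 ?divr_ge0 ?(ltW m0)//.
  rewrite sqr_enorm stereo_inftyB expr_div_n -natrX.
  rewrite ler_wpM2l// lef_pV2 ?posrE ?exprn_gt0//.
    rewrite -sqr_enorm (@le_trans _ _ (enorm x ^+ 2)) ?lerDr//.
    by rewrite ler_pXn2r// ?nnegrE ?enorm_ge0 ?ltW.
  by rewrite ltr_pwDl ?sqnorm_ge0.
apply: ge_inf; first by exists 0 => z [].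
by split; [rewrite divr_ge0// ltW|exact: h|apply: h].
Qed.

End Geometry.

(** * Recurrence of local configurations *)

Lemma finite_uniform (R : realType) (T : choiceType) (A : set T)
    (P : T -> R -> Prop) : finite_set A ->
  (forall x e e', 0 < e' -> e' <= e -> P x e -> P x e') ->
  (forall x, A x -> exists2 e, 0 < e & P x e) ->
  exists2 e, 0 < e & forall x, A x -> P x e.
Proof.
move=> /finite_seqP[s ->] mono; elim: s => [_|x s IH AP]; first by exists 1.
have [|e e0 eP] := IH; first by move=> y ys; apply: AP; rewrite /= inE; apply/orP; right.
have [|e' e'0 xe'] := AP x; first by rewrite /= mem_head.
exists (Num.min e e'); first by rewrite lt_min e0.
have m0 : 0 < Num.min e e' by rewrite lt_min e0.
move=> y; rewrite /= inE => /orP[/eqP ->|ys].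
  by apply: mono xe' => //; rewrite ge_min lexx orbT.
by apply: mono (eP _ ys) => //; rewrite ge_min lexx.
Qed.

(** An ultrafilter contains either the fiber of [x] or its complement; in the latter case one value
    fewer is left. *)
Lemma ultra_pigeonhole (T : Type) (X : choiceType) (U : set_system T)
    (f : T -> X) (A : set X) : UltraFilter U -> finite_set A ->
  U (f @^-1` A) -> exists2 a, A a & U (f @^-1` [set a]).
Proof.
move=> UU /finite_seqP[s ->]; elim: s => [|x s IH] Us.
  have : U set0 by apply: filterS Us => t.
  by move/filter_not_empty.
have [Ux|nUx] := in_ultra_setVsetC (f @^-1` [set x]) UU.
  by exists x => //=; rewrite mem_head.
have /IH[a sa Ua] : U (f @^-1` [set` s]).
  apply: filterS (filterI Us nUx) => t /=; rewrite inE.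
  by case=> /orP[/eqP|].
by exists a => //=; rewrite inE; apply/orP; right.
Qed.

Section Systems.
Context {R : realType} {d : nat}.
Local Notation V := 'rV[R]_d.
Local Notation shift := Defs.shift.
Implicit Types (x y p q t u v : V).
Variable Omega : set (closed_set R d).
Hypothesis ddsf : is_ddsf Omega.

Lemma dds_separated w : Omega w -> exists2 r : R, 0 < r & separated r w.
Proof. by move=> /(dds_delone (ddsf_dds ddsf))[r [s [r0 _ sep _]]]; exists r. Qed.

Lemma dds_relatively_dense w : Omega w ->
  exists2 s : R, 0 < s & forall x, exists2 p, closed_set_val w p & enorm (x - p) <= s.
Proof.
move=> /(dds_delone (ddsf_dds ddsf))[r [s [_ s0 _ dense]]]; exists s => // x.
by have [p [xp wp]] := dense x; exists p.
Qed.

Lemma dds_finite w p (s : R) : Omega w -> finite_set (closed_set_val w `&` cball p s).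
Proof. by move=> /dds_separated[r r0 sep]; apply: finite_separated sep. Qed.

Lemma finite_loc w p (s : R) : Omega w -> finite_set (loc s w p).
Proof.
move=> Ow; apply: sub_finite_set (finite_image (fun x => x - p) (dds_finite p s Ow)).
move=> v [vs wv]; exists (p + v); last by rewrite addrAC subrr add0r.
by split => //; rewrite /cball/= opprD addNKr enormN.
Qed.

(* Finite local complexity makes the difference vectors of bounded length
   uniformly separated over the whole system. *)
Lemma difference_gap (s : R) : 0 < s ->
  exists2 e : R, 0 < e & forall w w' p p' u v, Omega w -> Omega w' ->
    closed_set_val w p -> closed_set_val w' p' ->
    loc s w p u -> loc s w' p' v -> enorm (u - v) < e -> u = v.
Proof.
move=> s0.
pose D := \bigcup_(L in [set L | exists w : closed_set R d, Omega w /\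
  exists2 p, closed_set_val w p & L = loc s w p]) L.
have fD : finite_set D.
  apply: bigcup_finite; first exact: finite_locs.
  by move=> L [w [Ow [p _ ->]]]; exact: finite_loc.
have [||e e0 eD] := finite_uniform
    (P := fun (q : V * V) (e : R) => enorm (q.1 - q.2) < e -> q.1 = q.2)
    (finite_setX fD fD).
- by move=> [u v] e e' _ ee h uv; apply: h; exact: lt_le_trans ee.
- move=> [u v] _ /=; have [->|/eqP uv] := eqVneq u v; first by exists 1.
  exists (enorm (u - v)); last by rewrite ltxx.
  rewrite lt0r enorm_ge0 andbT; apply/eqP => /enorm_eq0/eqP.
  by rewrite subr_eq0 => /eqP.
exists e => // w w' p p' u v Ow Ow' wp wp' lu lv.
by apply: (eD (u, v)); split; [exists (loc s w p) => //; exists w; split => //; exists p|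
  exists (loc s w' p') => //; exists w'; split => //; exists p'].
Qed.

(** By minimality some translate of [w'] is close to [w], so that points near [p] match up to a
    small error. The matched difference vectors belong to a uniformly separated set, hence the match
    is exact. *)
Lemma loc_occurs w w' p (s : R) : minimal Omega -> Omega w -> Omega w' ->
  closed_set_val w p -> 0 < s ->
  exists2 p', closed_set_val w' p' & loc s w' p' = loc s w p.
Proof.
(* Radius [s + 1] leaves room for the matching error [2 * e <= 1]. *)
move=> Om Ow Ow' wp s0; have s10 : 0 < s + 1 by lra.
have [gap gap0 gapP] := difference_gap s10.
pose e := Num.min (1 / 2) (gap / 2).
have e0 : 0 < e by rewrite lt_min !divr_gt0.
have [e1 eg] : 2 * e <= 1 /\ 2 * e <= gap.
  by split; rewrite -ler_pdivlMl// mulrC ge_min ?lexx ?orbT// mul1r.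
pose M := 1 + (enorm p + s + 2) ^+ 2.
have M1 : 1 <= M by rewrite lerDl sqr_ge0.
have M0 : 0 < M by lra.
(* [M] bounds [1 + sqnorm x] for all [x] within [s + 1] of [p]. From [c * M < e] and
   [c ^+ 2 * M <= 1], [natural_dist_near] yields matches with error less than [e]. *)
pose c := Num.min 1 (Num.min (e / 2 / M) M^-1).
have c0 : 0 < c by rewrite !lt_min ltr01 !divr_gt0 ?invr_gt0.
have [c1 cM1 cM2] : [/\ c <= 1, c * M < e & c * M <= 1].
  split; first by rewrite ge_min lexx.
    apply: (@le_lt_trans _ _ (e / 2)); last lra.
    by rewrite -ler_pdivlMr// !ge_min lexx orbT.
  by rewrite -ler_pdivlMr// div1r !ge_min lexx !orbT.
have [_ [[t _ <-] wt]] : (Defs.orbit w' `&` ball w c) !=set0.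
  by apply: (Om w' Ow' w Ow); exact: nbhsx_ballx.
have Owt : Omega (translate t w') by exact: (dds_invariant (ddsf_dds ddsf)).
have near (F G : closed_set R d) x : natural_dist F G < c ->
    enorm (x - p) <= s + 1 -> closed_set_val F x ->
    exists2 y, closed_set_val G y & enorm (x - y) < e.
  move=> FG xp Fx; have xM : 1 + sqnorm x <= M.
    rewrite lerD2l -sqr_enorm ler_pXn2r// ?nnegrE ?enorm_ge0//.
      have := enormB_le x p 0; rewrite !subr0; lra.
    by rewrite !addr_ge0 ?enorm_ge0// ltW.
  have x0 : 0 < 1 + sqnorm x by rewrite ltr_pwDl// sqnorm_ge0.
  have [|y Gy xy] := natural_dist_near (x := x) FG _ Fx.
    apply: le_trans cM2; rewrite ler_pM ?sqr_ge0 ?(ltW x0)//.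
    by rewrite expr2 ger_pMr.
  exists y => //; apply: le_lt_trans xy _; apply: le_lt_trans cM1.
  by rewrite ler_wpM2l// ltW.
have wt2 : natural_dist (translate t w') w < c by rewrite natural_dist_sym.
have [p'' wp'' pp''] : exists2 y, closed_set_val (translate t w') y & enorm (p - y) < e.
  by apply: near wt _ wp; rewrite subrr enorm0; lra.
(* A vector and its match differ by the errors at both endpoints, so by less than [2 * e <= gap],
   and therefore coincide. *)
have key : loc s w p = loc s (translate t w') p''.
  apply/seteqP; split => v [vs wv].
    have [|y wy vy] := near _ _ (p + v) wt _ wv.
      by rewrite addrAC subrr add0r; lra.
    have yv : enorm (v - (y - p'')) < 2 * e.
      rewrite (_ : v - (y - p'') = (p + v - y) + (p'' - p)); last first.
        by apply/rowP => i; rewrite !mxE; ring.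
      by rewrite (le_lt_trans (enormD _ _))// mulrDl mul1r ltrD// enormC.
    have yE : v = y - p''.
      apply: (gapP w (translate t w') p p'') => //; last exact: lt_le_trans eg.
        by split => //; lra.
      split; last by rewrite subrKC.
      have := enormB_le (y - p'') v 0; rewrite !subr0 [enorm (_ - v)]enormC; lra.
    by split => //; rewrite yE subrKC.
  have [|y wy vy] := near _ _ (p'' + v) wt2 _ wv.
    have := enormB_le (p'' + v) p'' p; rewrite [p'' + v - p'']addrAC subrr add0r.
    by rewrite [enorm (p'' - p)]enormC; lra.
  have yv : enorm (v - (y - p)) < 2 * e.
    rewrite (_ : v - (y - p) = (p'' + v - y) + (p - p'')); last first.
      by apply/rowP => i; rewrite !mxE; ring.
    by rewrite (le_lt_trans (enormD _ _))// mulrDl mul1r ltrD.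
  have yE : v = y - p.
    apply: (gapP (translate t w') w p'' p) => //; last exact: lt_le_trans eg.
      by split => //; lra.
    split; last by rewrite subrKC.
    have := enormB_le (y - p) v 0; rewrite !subr0 [enorm (_ - v)]enormC; lra.
  by split => //; rewrite yE subrKC.
exists (p'' - t); first by move: wp''; rewrite /= shiftE.
by rewrite key -{2}(subrK t p'') /= loc_shift.
Qed.

(* Otherwise translates of [w] avoiding the configuration on larger and larger
   balls have, by finite local complexity, an ultrafilter limit in [Omega] that
   avoids it everywhere. *)
Lemma loc_repetitive w p (s : R) : minimal Omega -> Omega w ->
  closed_set_val w p -> 0 < s ->
  exists S : R, forall x, exists p',
    [/\ closed_set_val w p', enorm (x - p') <= S & loc s w p' = loc s w p].
Proof.
move=> Om Ow wp s0; apply: contrapT => noS.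
have /choice[x xP] : forall n : nat, exists x, forall p', closed_set_val w p' ->
    enorm (x - p') <= n%:R -> loc s w p' <> loc s w p.
  move=> n; apply: contrapT => h; apply: noS; exists n%:R => x.
  apply: contrapT => h2; apply: h; exists x => p' wp' xp' lp; apply: h2.
  by exists p'.
have [r r0 dense] := dds_relatively_dense Ow.
have /choice[q qP] : forall n, exists q, closed_set_val w q /\ enorm (x n - q) <= r.
  by move=> n; have [q wq xq] := dense (x n); exists q.
(* A point of [w] near [x n] is moved to the origin, so that [loc m (W n) 0] takes only finitely
   many values. *)
pose W n := translate (- q n) w.
have OW n : Omega (W n) by exact: (dds_invariant (ddsf_dds ddsf)).
have W0 n : closed_set_val (W n) 0 by rewrite /= shiftE sub0r opprK; exact: (qP n).1.
have [U [UU Uoo]] := ultraFilterLemma (F := \oo : set_system nat) _.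
have UF : ProperFilter U by exact: ultra_proper.
(* The limit consists of the points lying in [U]-almost all [W n]; on each ball it equals [U]-almost
   all of them. *)
pose winf : set V := [set y | U [set n | closed_set_val (W n) y]].
have limit (m : R) : 0 < m -> U [set n | loc m (W n) 0 = loc m winf 0].
  move=> m0.
  have [|L _ UL] := ultra_pigeonhole (U := U) (f := fun n => loc m (W n) 0)
    UU (finite_locs ddsf m0).
    by apply: filterS (@filterT _ U _) => n _; exists (W n); split => //; exists 0.
  have -> : loc m winf 0 = L; last exact: UL.
  apply/seteqP; split => [v [vm]|v Lv].
    rewrite add0r => Uv.
    have [n [/= <- Wv]] := filter_ex (filterI UL Uv); split => //.
    by rewrite add0r.
  have [n /= nL] := filter_ex UL.
  move: (Lv); rewrite -nL => -[vm _]; split => //.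
  rewrite add0r /winf/=; apply: filterS UL => k /= kL.
  by move: Lv; rewrite -kL => -[_]; rewrite add0r.
have loc0 (w' : set V) m : loc m w' 0 = w' `&` cball 0 m.
  by apply/seteqP; split => v [h1 h2]; split => //;
    rewrite ?add0r in h2 *; rewrite /cball/= ?sub0r ?enormN in h2 *.
have cwinf : closed winf.
  (* The unit sup-norm ball around [y] stays within Euclidean distance [d] of [y], so it lies in
     [cball 0 m], where [winf] equals some closed [W n]. *)
  move=> y yc; pose m := enorm y + d%:R + 1.
  have m0 : 0 < m by rewrite ltr_wpDl// addr_ge0 ?enorm_ge0.
  have [n /= nm] := filter_ex (limit _ m0).
  suff : (W n `&` cball 0 m) y by rewrite -loc0 nm loc0 => -[].
  suff : closure (W n `&` cball 0 m) y.
    by apply: closedI; [exact: closed_setP|exact: closed_cball].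
  rewrite -loc0 nm loc0 => B By.
  have [z [wz [Bz yz]]] := yc _ (filterI By (nbhsx_ballx y 1 ltr01)).
  exists z; split => //; split => //.
  rewrite /cball/= sub0r enormN.
  have := enormB_le z y 0; rewrite !subr0 => /le_trans; apply.
  rewrite /m -addrA [leLHS]addrC lerD2l (@le_trans _ _ (d%:R * 1)) ?mulr1 ?lerDl//.
  rewrite -[leRHS]mulr1; apply: enorm_le_coord => i; rewrite !mxE.
  by case: yz => _ /(_ 0 i); rewrite /ball/= distrC => /ltW.
pose wi := ClosedSet cwinf.
have Owi : Omega wi.
  apply: (dds_closed (ddsf_dds ddsf)) => B /nbhs_ballP[e /= e0 eB].
  have m0 : 0 < 2 / e + 1 by rewrite ltr_wpDl// divr_ge0// ltW.
  have [n /= nm] := filter_ex (limit _ m0).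
  exists (W n); split; first exact: OW.
  apply: eB; rewrite /ball/=; apply: le_lt_trans (natural_dist_loc m0 _) _.
    by rewrite -!loc0 -nm.
  rewrite ltr_pdivrMr// mulrDr mulr1 mulrC divfK ?gt_eqF//; lra.
have [p' wp' lp'] := loc_occurs Om Ow Owi wp s0.
pose m := enorm p' + s.
have m0 : 0 < m by rewrite ltr_wpDl// enorm_ge0.
(* [n >= r + enorm p'] puts [p' + q n] within [n] of [x n], where the configuration was excluded. *)
have [n []] := filter_ex (filterI (limit _ m0)
  (Uoo _ (nbhs_infty_ger (r + enorm p')))) => /=.
rewrite !loc0 => nm nr.
have sub y : enorm y <= m -> closed_set_val (W n) y <-> winf y.
  move=> ym; have yc : cball 0 m y by rewrite /cball/= sub0r enormN.
  split=> h; [have : (W n `&` cball 0 m) y by []|have : (winf `&` cball 0 m) y by []].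
    by rewrite nm => -[].
  by rewrite -nm => -[].
apply: (xP n (p' + q n)).
- have : closed_set_val (W n) p' by apply/sub => //; rewrite /m lerDl ltW.
  by rewrite /= shiftE opprK.
- apply: le_trans nr; rewrite opprD addrCA addrC.
  by rewrite (le_trans (enormD _ _))// enormN lerD// (qP n).2.
- rewrite -lp' -[LHS](loc_shift _ _ _ (- q n)) addrK.
  apply/seteqP; split => v [vs wv]; split => //; apply/(sub (p' + v)) => //;
    by rewrite (le_trans (enormD _ _))// lerD2l.
Qed.

End Systems.

(** * Operators on finitely supported functions *)

Local Open Scope complex_scope.

Section SquareModulus.
Context {R : realType}.
Local Notation C := R[i].
Implicit Types z : C.

Lemma sqmod_ge0 z : 0 <= sqmod z.
Proof. by rewrite addr_ge0 ?sqr_ge0. Qed.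

Lemma sqmod0 : sqmod (0 : C) = 0.
Proof. by rewrite /sqmod expr0n addr0. Qed.

Lemma sqmod_eq0 z : sqmod z = 0 -> z = 0.
Proof.
case: z => a b /eqP; rewrite paddr_eq0 ?sqr_ge0//= !sqrf_eq0.
by move=> /andP[/eqP -> /eqP ->].
Qed.

Lemma sqmodM z z' : sqmod (z * z') = sqmod z * sqmod z'.
Proof. by case: z z' => a b [c e]; rewrite /sqmod/=; ring. Qed.

Lemma sqmodD_le z z' : sqmod (z + z') <= 2 * (sqmod z + sqmod z').
Proof.
case: z z' => a b [c e]; rewrite /sqmod/= -subr_ge0.
rewrite (_ : _ - _ = (a - c) ^+ 2 + (b - e) ^+ 2); last by ring.
by rewrite addr_ge0 ?sqr_ge0.
Qed.

(** The crude constant comes from iterating [sqmodD_le]; only its independence of [F] matters. *)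
Lemma sqmod_sum_le (I : Type) (s : seq I) (F : I -> C) :
  sqmod (\sum_(i <- s) F i) <= 2 ^+ size s * \sum_(i <- s) sqmod (F i).
Proof.
elim: s => [|i s IH]; first by rewrite !big_nil sqmod0 mulr0.
rewrite !big_cons (le_trans (sqmodD_le _ _))// exprS -mulrA ler_pM2l//.
rewrite mulrDr lerD// ler_peMl ?sqmod_ge0// exprn_ege1//; lra.
Qed.

Lemma sqmod_mulmx_le m n (B : 'M[C]_(m, n)) : exists2 K : R, 0 < K &
  forall y : 'rV[C]_m, \sum_i sqmod ((y *m B) 0 i) <= K * \sum_j sqmod (y 0 j).
Proof.
pose K := \sum_i 2 ^+ m * \sum_j sqmod (B j i).
have K0 : 0 <= K.
  by apply: sumr_ge0 => i _; rewrite mulr_ge0 ?sumr_ge0 ?exprn_ge0// => j _; exact: sqmod_ge0.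
exists (K + 1) => [|y]; first by rewrite ltr_wpDl.
have y0 : 0 <= \sum_j sqmod (y 0 j) by apply: sumr_ge0 => j _; exact: sqmod_ge0.
rewrite mulrDl mul1r (@le_trans _ _ (K * \sum_j sqmod (y 0 j))) ?lerDl//.
rewrite /K mulr_suml; apply: ler_sum => i _; rewrite mxE.
apply: (le_trans (sqmod_sum_le _ _)).
rewrite -[index_enum _]enumT size_enum_ord -mulrA ler_pM2l ?exprn_gt0// enumT.
rewrite mulr_suml; apply: ler_sum => j _; rewrite sqmodM mulrC ler_wpM2l ?sqmod_ge0//.
by rewrite (bigD1 j)//= lerDl sumr_ge0// => k _; exact: sqmod_ge0.
Qed.

End SquareModulus.

Section FiniteSupport.
Context {R : realType} {d : nat}.
Local Notation V := 'rV[R]_d.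
Local Notation C := R[i].
Implicit Types (x y p q t u v : V) (f g : V -> C).

(** The enumeration that [local_dos] uses, so that facts about [pts] apply to the restricted
    matrices. *)
Definition pts (S : set V) : seq V := finmap.enum_fset (fset_set S).

Lemma pts_uniq S : uniq (pts S).
Proof. exact: finmap.fset_uniq. Qed.

Lemma mem_pts S x : finite_set S -> (x \in pts S) = (x \in S).
Proof. by move=> fS; exact: in_fset_set. Qed.

Lemma ptsP S x : finite_set S -> reflect (S x) (x \in pts S).
Proof. by move=> fS; rewrite mem_pts//; apply: (iffP idP); rewrite inE. Qed.

(** The squared l^2 norm of a finitely supported [f], as a real number; for infinite support the
    value is 0. *)
Definition nsq f : R := \sum_(x \in [set: V]) sqmod (f x).

Lemma nsqE (s : seq V) f : uniq s -> (forall x, f x <> 0 -> x \in s) ->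
  nsq f = \sum_(x <- s) sqmod (f x).
Proof.
move=> us fs; rewrite /nsq (fsbigE s)//; first by apply: eq_bigl => x; rewrite in_setT.
by move=> x _ xs; have [->|/eqP /fs] := eqVneq (f x) 0; [exact: sqmod0|rewrite (negPf xs)].
Qed.

Lemma ell2_finite (w S : set V) f : finite_set S -> S `<=` w ->
  (forall x, f x <> 0 -> S x) -> ell2 w f.
Proof.
move=> fS Sw fsupp; split.
  by move=> x nwx; apply: contrapT => /fsupp/Sw.
rewrite /ell2_sqnorm (_ : \esum_(x in w) _ = \esum_(x in S) (sqmod (f x))%:E).
  rewrite esum_fset// => [|i _]; last by rewrite lee_fin sqmod_ge0.
  by rewrite fsbig_finite//= sumEFin ltry.
rewrite esum_mkcond [RHS]esum_mkcond; apply: eq_esum => x _.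
have [xS|xS] := boolP (x \in S).
  by rewrite mem_set//; apply: Sw; exact: set_mem.
case: ifP => // _; have [->|/eqP /fsupp /mem_set] := eqVneq (f x) 0; first by rewrite sqmod0.
by rewrite (negPf xS).
Qed.

(** Extension by zero: outside [s] the index is [size s], and [insub] fails. *)
Definition extend (s : seq V) (u : 'I_(size s) -> C) x : C :=
  if insub (index x s) is Some i then u i else 0.

Lemma extendE (s : seq V) (u : 'I_(size s) -> C) (i : 'I_(size s)) :
  uniq s -> extend u s`_i = u i.
Proof. by move=> us; rewrite /extend index_uniq// valK. Qed.

Lemma extend_supp (s : seq V) (u : 'I_(size s) -> C) x : extend u x <> 0 -> x \in s.
Proof. by rewrite /extend -index_mem; case: insubP => // i. Qed.

Lemma real_sum1 (w : set V) (g : V -> R) x : w x ->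
  (forall z, z <> x -> g z = 0) -> real_sum w g = g x.
Proof.
move=> wx g0.
have h (a : V -> R) : 0 <= a x -> (forall z, z <> x -> a z = 0) ->
    \esum_(z in w) (a z)%:E = (a x)%:E.
  move=> ax a0; rewrite esum_mkcond -[RHS](@esum_set1 _ _ x (EFin \o a)) ?lee_fin//.
  rewrite [RHS]esum_mkcond; apply: eq_esum => z _.
  have [->|/eqP zx] := eqVneq z x; first by rewrite !mem_set.
  by rewrite (memNset (A := [set x]))//=; case: ifP => // _; rewrite a0.
rewrite /real_sum !h/=; try by rewrite le_max lexx orbT.
- case/orP: (le_total 0 (g x)) => gx.
    by rewrite (max_idPl gx) (max_idPr _) ?oppr_le0// subr0.
  by rewrite (max_idPr gx) (max_idPl _) ?oppr_ge0// sub0r opprK.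
- by move=> z zx; rewrite g0// oppr0 maxxx.
- by move=> z zx; rewrite g0// maxxx.
Qed.

End FiniteSupport.

Section Operators.
Context {R : realType} {d : nat}.
Local Notation V := 'rV[R]_d.
Local Notation C := R[i].
Implicit Types (x y p q t u v : V) (f g : V -> C) (w : set V).

Lemma basis_vector_ell2 w y : w y -> ell2 w (basis_vector y).
Proof.
move=> wy; apply: (@ell2_finite _ _ w [set y]) => // [x ->//|x].
by rewrite /basis_vector; case: eqVneq.
Qed.

(** Linearity is stated for [a * f + g] only; [a = -1] and [f = g = 0] make the right side
    cancel. *)
Lemma operator0 w (T : @operator R d) : bounded_operator w T ->
  T (fun=> 0) = (fun=> 0).
Proof.
move=> bT; have l0 : ell2 w (fun=> 0) by exact: (@ell2_finite _ _ w set0).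
have := operator_linear bT (-1) l0 l0.
rewrite (_ : (fun x => -1 * 0 + 0) = (fun=> 0)); last first.
  by apply/funext => x; rewrite mulr0 addr0.
by move=> ->; apply/funext => x; rewrite mulN1r addNr.
Qed.

Lemma operatorE w (T : @operator R d) (s : seq V) f x : bounded_operator w T ->
  uniq s -> (forall y, y \in s -> w y) -> (forall y, f y <> 0 -> y \in s) ->
  T f x = \sum_(y <- s) matrix_element T x y * f y.
Proof.
move=> bT; elim: s f => [|y s IH] f /=.
  move=> _ _ f0; rewrite big_nil (_ : f = fun=> 0) ?(operator0 bT)//.
  by apply/funext => z; apply: contrapT => /f0.
move=> /andP[ys us] sw fs.
pose g z := if z == y then 0 else f z.
have gs z : g z <> 0 -> z \in s.
  by rewrite /g; case: eqVneq => // zy /fs; rewrite inE (negPf zy).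
have sw' z : z \in s -> w z by move=> zs; apply: sw; rewrite inE zs orbT.
have -> : f = (fun z => f y * basis_vector y z + g z).
  apply/funext => z; rewrite /basis_vector /g.
  by case: eqVneq => [->|_]; rewrite ?mulr1 ?addr0 ?mulr0 ?add0r.
rewrite (operator_linear bT); first 1 last.
- by apply: basis_vector_ell2; apply: sw; rewrite mem_head.
- apply: (@ell2_finite _ _ w [set` s]) => //=; exact: finite_seq.
rewrite big_cons (IH g us sw' gs); congr (_ + _).
  rewrite mulrC; congr (_ * _).
  by rewrite /basis_vector eqxx mulr1 /g eqxx addr0.
rewrite [LHS]big_seq [RHS]big_seq; apply: eq_bigr => z zs; congr (_ * _).
rewrite /g /basis_vector; case: eqVneq zs => [->|_ _]; first by rewrite (negPf ys).
by rewrite mulr0 add0r.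
Qed.

Lemma matrix_element_herm w (T : @operator R d) x y : bounded_operator w T ->
  selfadjoint_operator w T -> w x -> w y ->
  matrix_element T x y = conjc (matrix_element T y x).
Proof.
move=> bT sT wx wy.
have := sT _ _ (basis_vector_ell2 wx) (basis_vector_ell2 wy).
rewrite /ell2_dot (real_sum1 wx); last first.
  by move=> z zx; rewrite /basis_vector (negPf (introN eqP zx)) conjc0 mul0r.
rewrite (real_sum1 wx); last first.
  by move=> z zx; rewrite /basis_vector (negPf (introN eqP zx)) conjc0 mul0r.
rewrite (real_sum1 wy); last first.
  by move=> z zy; rewrite /basis_vector (negPf (introN eqP zy)) mulr0.
rewrite (real_sum1 wy); last first.
  by move=> z zy; rewrite /basis_vector (negPf (introN eqP zy)) mulr0.
rewrite /basis_vector !eqxx conjc1 mulr1 mul1r -!/(basis_vector _) => h.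
by rewrite /matrix_element; move: h; case: (T _ x); case: (conjc _).
Qed.

(** The two domains always correspond under the translation, so only the points inside them are to
    be compared. *)
Lemma pair_patternP (r : R) w w' x y t :
  pair_pattern r w' (x + t) (y + t) = shift_pattern t (pair_pattern r w x y) <->
  (forall z, (enorm (x - z) <= r \/ enorm (y - z) <= r) -> w z <-> w' (z + t)).
Proof.
have ball_t (z z' : V) : cball (z + t) r (z' + t) = cball z r z'.
  by rewrite /cball/= opprD addrACA subrr addr0.
split=> [[ww _] z xyz|ww].
  have := congr1 (fun S : set V => S (z + t)) ww.
  rewrite shiftE addrK /setI/=.
  rewrite /setU/= !ball_t => h.
  by split => wz; [have : w z /\ (cball x r z \/ cball y r z) by []; rewrite -h => -[]|
     have : w' (z + t) /\ (cball x r z \/ cball y r z) by []; rewrite h => -[]].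
rewrite /pair_pattern /wedge /shift_pattern/=.
have Q : cball (x + t) r `|` cball (y + t) r = Defs.shift t (cball x r `|` cball y r).
  apply/seteqP; split => z; rewrite shiftE.
    by rewrite -{1}(subrK t z) /setU/= !ball_t.
  by rewrite -{2}(subrK t z) /setU/= !ball_t.
congr pair => //; apply/seteqP; split => z; rewrite shiftE.
  by rewrite Q => -[wz]; rewrite shiftE => xyz; split => //; apply/ww => //; rewrite subrK.
by move=> [wz xyz]; split; [move/(ww _ xyz) : wz; rewrite subrK|rewrite Q shiftE].
Qed.

Lemma finite_range_mono (Omega : set (closed_set R d)) A (r r' : R) :
  r <= r' -> finite_range Omega A r -> finite_range Omega A r'.
Proof.
move=> rr' [A0 Ap]; split=> [w Ow x y wx wy rxy|]; first by apply: A0 => //; lra.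
move=> w w' Ow Ow' x y t wx wy wx' wy' /pair_patternP ww; apply: Ap => //.
by apply/pair_patternP => z xyz; apply: ww; case: xyz; [left|right]; lra.
Qed.

(** The balls of radius [r] around [p + u] and [p + v] lie within [s + r] of [p], where the two
    configurations agree. *)
Lemma finite_range_loc (Omega : set (closed_set R d)) A (r s : R)
    (w w' : closed_set R d) p p' u v :
  0 <= r -> finite_range Omega A r -> Omega w -> Omega w' ->
  loc (s + r) w p = loc (s + r) w' p' -> loc s w p u -> loc s w p v ->
  matrix_element (A w') (p' + u) (p' + v) = matrix_element (A w) (p + u) (p + v).
Proof.
move=> r0 [_ Ap] Ow Ow' ww' [us wu] [vs wv].
have sr : s <= s + r by rewrite lerDl.
have loc' z : loc s w p z -> closed_set_val w' (p' + z).
  move=> [zs wz]; have : loc (s + r) w p z by split => //; exact: le_trans sr.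
  by rewrite ww' => -[].
have sh z : p' + z = p + z + (p' - p) by rewrite addrAC subrKC.
have [wu' wv'] := (loc' u (conj us wu), loc' v (conj vs wv)).
rewrite (sh u) (sh v) in wu' wv' *; apply: Ap => //.
apply/pair_patternP => z xyz.
have zs : enorm (z - p) <= s + r.
  case: xyz => h; [have := enormB_le z (p + u) p|have := enormB_le z (p + v) p];
    rewrite addrAC subrr add0r [enorm (z - (_ + _))]enormC; lra.
have [zp zp'] : p + (z - p) = z /\ p' + (z - p) = z + (p' - p).
  by rewrite subrKC; split => //; rewrite addrCA.
split=> wz.
  have : loc (s + r) w p (z - p) by split => //; rewrite zp.
  by rewrite ww' => -[_]; rewrite zp'.
have : loc (s + r) w' p' (z - p) by split => //; rewrite zp'.
by rewrite -ww' => -[_]; rewrite zp.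
Qed.

End Operators.

(** * Locally supported eigenfunctions *)

Section Eigenfunctions.
Context {R : realType} {d : nat}.
Local Notation V := 'rV[R]_d.
Local Notation C := R[i].
Implicit Types (w : closed_set R d) (x y p q t u v : V) (f g : V -> C).
Variables (Omega : set (closed_set R d)) (A : closed_set R d -> @operator R d).
Hypothesis ddsf : is_ddsf Omega.
Hypothesis boundedA : forall w, Omega w -> bounded_operator w (A w).
Variable r : R.
Hypothesis r_gt0 : 0 < r.
Hypothesis rangeA : finite_range Omega A r.
Variable E : R.

(* [A_w f - E f] for [f] supported near [p], in coordinates centered at [p], so
   that it depends only on a local configuration of [w] around [p]. *)
Definition defect w p (D : R) g u : C :=
  \sum_(v <- pts (loc D w p)) matrix_element (A w) (p + u) (p + v) * g v
  - E%:C * g u.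

Lemma ell2_local w p (D : R) f : Omega w ->
  (forall x, f x <> 0 -> closed_set_val w x /\ enorm (x - p) <= D) -> ell2 w f.
Proof.
move=> Ow fs; apply: (ell2_finite (dds_finite ddsf p D Ow)); first by move=> x [].
by move=> x /fs[wx xD]; split => //; rewrite /cball/= enormC.
Qed.

(** Finite range makes [A w f] vanish at points of [w] farther than [D + r] from [p]; off [w] it
    vanishes as an element of l^2(w). *)
Lemma defectE w p (D : R) f u : Omega w ->
  (forall x, f x <> 0 -> closed_set_val w x /\ enorm (x - p) <= D) ->
  A w f (p + u) - E%:C * f (p + u) =
  if `[< loc (D + r) w p u >] then defect w p D (fun v => f (p + v)) u else 0.
Proof.
move=> Ow fs; have fl := finite_loc ddsf p D Ow.
have f0 : forall y, f y <> 0 -> loc D w p (y - p).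
  by move=> y /fs[wy yp]; split => //; rewrite subrKC.
have l2 := ell2_local Ow fs.
have fu0 : ~ loc D w p u -> f (p + u) = 0.
  by move=> nu; apply: contrapT => /f0; rewrite addrAC subrr add0r.
have [wu|nwu] := pselect (closed_set_val w (p + u)); last first.
  have := operator_ell2 (boundedA Ow) l2 => -[-> //].
  by rewrite sub0r fu0 ?mulr0 ?oppr0 => [|[]//]; case: asboolP => // -[].
rewrite (@operatorE _ _ w (A w) [seq p + v | v <- pts (loc D w p)]); first last.
- by move=> y /f0/ptsP-/(_ fl) yl; apply/mapP; exists (y - p) => //; rewrite subrKC.
- by move=> _ /mapP[v /(ptsP _ fl)[_ wv] ->].
- by rewrite map_inj_uniq ?pts_uniq//; exact: addrI.
- exact: boundedA.
rewrite big_map; case: asboolP => // nu.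
have Du : D + r < enorm u by rewrite ltNge; apply/negP => uD; apply: nu.
rewrite fu0 => [|[uD _]]; last by have := r_gt0; lra.
rewrite mulr0 subr0 big_seq big1// => v /(ptsP _ fl)[vD wv].
rewrite rangeA.1 ?mul0r//.
have := enormB_le u v 0; rewrite !subr0 (_ : p + u - (p + v) = u - v); first by have := r_gt0; lra.
by rewrite opprD addrACA subrr add0r.
Qed.

(** One summand [r] covers the points to which [A w] spreads [g], the other the patterns on which
    matrix elements depend. *)
Lemma defect_loc w w' p p' (D : R) g u : Omega w -> Omega w' ->
  loc (D + r + r) w p = loc (D + r + r) w' p' -> loc (D + r) w p u ->
  defect w' p' D g u = defect w p D g u.
Proof.
move=> Ow Ow' ll lu.
have lD : loc D w p = loc D w' p' by apply: loc_mono ll; have := r_gt0; lra.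
rewrite /defect -lD; congr (_ - _); rewrite [LHS]big_seq [RHS]big_seq.
apply: eq_bigr => v /(ptsP _ (finite_loc ddsf _ _ Ow))[vD wv]; congr (_ * _).
by apply: (finite_range_loc (ltW r_gt0) rangeA Ow Ow' ll) => //; split => //; have := r_gt0; lra.
Qed.

(** An eigenfunction supported near [p], phrased so that only [loc (D + r + r) w p] matters; it can
    thus be copied wherever this configuration recurs. *)
Definition singular w p (D : R) := exists g,
  [/\ forall v, g v <> 0 -> loc D w p v, exists v, g v <> 0 &
      forall u, loc (D + r) w p u -> defect w p D g u = 0].

Lemma singular_loc w w' p p' (D : R) : Omega w -> Omega w' ->
  loc (D + r + r) w p = loc (D + r + r) w' p' ->
  singular w p D -> singular w' p' D.
Proof.
move=> Ow Ow' ll [g [gs g0 gd]]; exists g; split => //.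
  by rewrite -(@loc_mono _ _ (D + r + r) D w w' p p')//; have := r_gt0; lra.
move=> u lu; have lu' : loc (D + r) w p u.
  by rewrite (@loc_mono _ _ (D + r + r) _ w w' p p')//; have := r_gt0; lra.
by rewrite (@defect_loc w w' p p')// gd.
Qed.

Lemma singular_eigenfunction w p (D : R) : Omega w -> singular w p D ->
  exists2 f, locally_supported_eigenfunction w (A w) E f &
    forall x, f x <> 0 -> closed_set_val w x /\ enorm (x - p) <= D.
Proof.
move=> Ow [g [gs [v gv] gd]]; pose f x := g (x - p).
have fs x : f x <> 0 -> closed_set_val w x /\ enorm (x - p) <= D.
  by move=> /gs[xD]; rewrite subrKC.
exists f => //; split.
- exact: ell2_local fs.
- by move=> /(congr1 (fun h => h (p + v))); rewrite /f addrAC subrr add0r.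
- apply/funext => x; apply/eqP; rewrite -subr_eq0 -(subrKC p x); apply/eqP.
  rewrite (defectE _ Ow fs); case: asboolP => // /gd <-; congr defect.
  by apply/funext => z; rewrite /f addrAC subrr add0r.
- exists (cball p D); first exact: compact_cball.
  by move=> x /fs[_ xD]; rewrite /cball/= enormC.
Qed.

Lemma eigenfunction_singular w p f : Omega w ->
  locally_supported_eigenfunction w (A w) E f ->
  exists2 D : R, 0 < D & singular w p D.
Proof.
move=> Ow [l2 fn0 fE [K /compact_sub_cball[s Ks] fK]].
(* The support lies in [cball 0 s], hence within [s + enorm p] of [p]; the absolute value and the 1
   ensure positivity. *)
pose D := `|s| + enorm p + 1.
have fs x : f x <> 0 -> closed_set_val w x /\ enorm (x - p) <= D.
  move=> fx; split; first by apply: contrapT => /l2.1.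
  have := Ks _ (fK _ fx); rewrite /cball/= sub0r enormN => xs.
  have := enormB_le x 0 p; rewrite subr0 sub0r enormN.
  by have := ler_norm s; rewrite /D; lra.
exists D; first by rewrite ltr_wpDl// addr_ge0 ?enorm_ge0.
exists (fun v => f (p + v)); split.
- by move=> v /fs[wv]; rewrite addrAC subrr add0r.
- apply: contrapT => h; apply: fn0; apply/funext => x; apply: contrapT => fx.
  by apply: h; exists (x - p); rewrite subrKC.
- move=> u lu; have := defectE u Ow fs; rewrite asboolT// => <-.
  by rewrite fE subrr.
Qed.

Lemma eigenfunction_transfer w w' f : Defs.minimal Omega -> Omega w -> Omega w' ->
  locally_supported_eigenfunction w (A w) E f ->
  exists f', locally_supported_eigenfunction w' (A w') E f'.
Proof.
move=> min Ow Ow' lf.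
have [_ _ /(_ 0)[p wp _]] := dds_relatively_dense ddsf Ow.
have [D D0 sD] := eigenfunction_singular p Ow lf.
have s0 : 0 < D + r + r by have := r_gt0; lra.
have [p' wp' ll] := loc_occurs ddsf min Ow Ow' wp s0.
have [f' lf' _] := singular_eigenfunction Ow' (singular_loc Ow Ow' (esym ll) sD).
by exists f'.
Qed.

Lemma eigenfunction_repetitive w f : Defs.minimal Omega -> Omega w ->
  locally_supported_eigenfunction w (A w) E f ->
  exists2 S : R, 0 < S & forall x, exists2 f',
    locally_supported_eigenfunction w (A w) E f' &
    forall y, f' y <> 0 -> enorm (y - x) <= S.
Proof.
move=> min Ow lf.
have [_ _ /(_ 0)[p wp _]] := dds_relatively_dense ddsf Ow.
have [D D0 sD] := eigenfunction_singular p Ow lf.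
have s0 : 0 < D + r + r by have := r_gt0; lra.
have [S SP] := loc_repetitive ddsf min Ow wp s0.
exists (D + `|S|) => [|x]; first by rewrite ltr_pwDl.
have [p' [wp' xp' ll]] := SP x.
have [f' lf' fs] := singular_eigenfunction Ow (singular_loc Ow Ow (esym ll) sD).
exists f' => // y /fs[_ yD]; have := enormB_le y p' x.
by rewrite [enorm (p' - x)]enormC; have := ler_norm S; lra.
Qed.

(** The quantitative negation of [singular], again depending on a local configuration only. *)
Definition coercive w p (D e : R) := forall g,
  (forall v, g v <> 0 -> loc D w p v) ->
  e * \sum_(v <- pts (loc D w p)) sqmod (g v) <=
  \sum_(u <- pts (loc (D + r) w p)) sqmod (defect w p D g u).

Lemma coercive_loc w w' p p' (D e : R) : Omega w -> Omega w' ->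
  loc (D + r + r) w p = loc (D + r + r) w' p' ->
  coercive w p D e -> coercive w' p' D e.
Proof.
move=> Ow Ow' ll h g gs.
have lD : loc D w p = loc D w' p' by apply: loc_mono ll; have := r_gt0; lra.
have lDr : loc (D + r) w p = loc (D + r) w' p' by apply: loc_mono ll; have := r_gt0; lra.
rewrite -lD -lDr (le_trans (h g _))//; first by rewrite lD.
rewrite big_seq [leRHS]big_seq ler_sum// => u.
move=> /(ptsP _ (finite_loc ddsf _ _ Ow)) lu.
by rewrite (@defect_loc w w' p p').
Qed.

(** On functions supported in [loc D w p], [A w - E] is an injective linear map between
    finite-dimensional spaces, so it has a one-sided inverse, and the inverse is bounded. *)
Lemma coercive_nonsingular w p (D : R) : Omega w -> ~ singular w p D ->
  exists2 e, 0 < e & coercive w p D e.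
Proof.
move=> Ow ns; pose s1 := pts (loc D w p); pose s2 := pts (loc (D + r) w p).
have f1 := finite_loc ddsf p D Ow.
have f2 := finite_loc ddsf p (D + r) Ow.
(* Acting on row vectors; rectangular, since the image is supported in the larger set
   [loc (D + r) w p]. *)
pose N : 'M[C]_(size s1, size s2) := \matrix_(i, j)
  (matrix_element (A w) (p + s2`_j) (p + s1`_i) - E%:C * (s2`_j == s1`_i)%:R).
have NE g (j : 'I_(size s2)) : (forall v, g v <> 0 -> loc D w p v) ->
    ((\row_i g s1`_i) *m N) 0 j = defect w p D g s2`_j.
  move=> gs; rewrite mxE /defect -/s1 (big_nth 0) big_mkord.
  rewrite (_ : E%:C * _ = \sum_(i < size s1) E%:C * (g s1`_i * (s2`_j == s1`_i)%:R)).
    by rewrite -sumrB; apply: eq_bigr => i _; rewrite !mxE; ring.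
  rewrite -mulr_sumr; congr (_ * _).
  have [h|h] := boolP (s2`_j \in s1).
    have hi : (index (s2`_j)%R s1 < size s1)%N by rewrite index_mem.
    rewrite (bigD1 (Ordinal hi))//= big1 ?addr0 => [|i ni].
      by rewrite nth_index// eqxx mulr1.
    case: eqP => [e|_]; last by rewrite mulr0.
    by move: ni; rewrite -val_eqE/= e index_uniq ?eqxx// pts_uniq.
  rewrite big1 => [|i _].
    by apply: contrapT => /gs/(ptsP _ f1); rewrite -/s1 (negPf h).
  by case: eqP => [e|_]; rewrite ?mulr0//; move: h; rewrite e mem_nth.
have /row_freeP[B NB] : row_free N.
  rewrite -kermx_eq0; apply/rowV0P => z /sub_kermxP zN.
  apply: contrapT => /eqP z0; apply: ns.
  pose g := extend (fun i : 'I_(size s1) => z 0 i).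
  have gE (i : 'I_(size s1)) : g s1`_i = z 0 i by rewrite /g extendE ?pts_uniq.
  have gs v : g v <> 0 -> loc D w p v by move=> /extend_supp/(ptsP _ f1).
  have zE : z = \row_i g s1`_i by apply/rowP => i; rewrite mxE gE.
  exists g; split => //.
    have /rV0Pn[i zi] := z0; exists s1`_i; rewrite gE; exact/eqP.
  move=> u /(ptsP _ f2) us; have hu : (index u s2 < size s2)%N by rewrite index_mem.
  have := NE g (Ordinal hu) gs; rewrite -zE zN mxE /= nth_index//.
have [K K0 BK] := sqmod_mulmx_le B.
exists K^-1; first by rewrite invr_gt0.
move=> g gs; rewrite ler_pdivrMl//.
have := BK ((\row_i g s1`_i) *m N); rewrite -mulmxA NB mulmx1.
rewrite -/s1 -/s2 (big_nth 0 (r := s1)) (big_nth 0 (r := s2)) !big_mkord.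
under eq_bigr do rewrite mxE.
by under [in leRHS]eq_bigr do rewrite NE//.
Qed.

(** The constant depends on the configuration around [p] only, and finitely many configurations
    occur, so one [e] serves all [p]. *)
Lemma nsq_coercive w (D : R) : Omega w -> 0 < D ->
  (forall f, ~ locally_supported_eigenfunction w (A w) E f) ->
  exists2 e, 0 < e & forall p f, closed_set_val w p ->
    (forall x, f x <> 0 -> closed_set_val w x /\ enorm (x - p) <= D) ->
    e * nsq f <= nsq (fun x => A w f x - E%:C * f x).
Proof.
move=> Ow D0 noeig.
have s0 : 0 < D + r + r by have := r_gt0; lra.
have [||e e0 eP] := finite_uniform (P := fun L e => forall p, closed_set_val w p ->
    loc (D + r + r) w p = L -> coercive w p D e) (finite_locs ddsf s0).
- move=> L e e' e'0 ee h p wp lp g gs; apply: le_trans (h p wp lp g gs).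
  by rewrite ler_wpM2r// sumr_ge0// => v _; exact: sqmod_ge0.
- move=> L _; have [[p wp pL]|nL] := pselect (exists2 p, closed_set_val w p &
      loc (D + r + r) w p = L); last first.
    (* A configuration that does not occur in [w] imposes no condition, so any constant will do. *)
    by exists 1 => // p wp pL; case: nL; exists p.
  have [|e e0 ce] := @coercive_nonsingular w p D Ow.
    by move=> /(singular_eigenfunction Ow)[f /noeig].
  by exists e => // p' wp' p'L; apply: coercive_loc ce => //; rewrite pL.
exists e => // p f wp fs.
have f1 := finite_loc ddsf p D Ow.
have f2 := finite_loc ddsf p (D + r) Ow.
have up S : uniq [seq p + v | v <- pts S].
  by rewrite map_inj_uniq ?pts_uniq//; exact: addrI.
rewrite (nsqE (up (loc D w p))) ?big_map => [|x /fs[wx xD]]; last first.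
  by apply/mapP; exists (x - p); rewrite ?subrKC//; apply/ptsP => //; split => //; rewrite subrKC.
rewrite (nsqE (up (loc (D + r) w p))) ?big_map; last first.
  move=> x; rewrite -(subrKC p x) (defectE _ Ow fs); case: asboolP => // lx _.
  by apply/mapP; exists (x - p) => //; apply/ptsP.
have cw : coercive w p D e.
  by apply: (eP (loc (D + r + r) w p)) => //; exists w; split => //; exists p.
have h := cw (fun v => f (p + v)); apply: le_trans (h _) _.
  by move=> v /fs[wv]; rewrite addrAC subrr add0r.
rewrite big_seq [leRHS]big_seq ler_sum// => u /(ptsP _ f2) lu.
by rewrite (defectE _ Ow fs) asboolT.
Qed.

End Eigenfunctions.

(** * Hermitian matrices *)

Section Spectral.
Context {R : realType}.
Local Notation C := R[i].
Local Open Scope sesquilinear_scope.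

Lemma conjC_conjc (z : C) : Num.conj z = conjc z.
Proof. by []. Qed.

Lemma hermsymmxP n (M : 'M[C]_n) :
  (forall i j, M i j = conjc (M j i)) -> M \is hermsymmx.
Proof.
move=> MM; apply/is_hermitianmxP; rewrite expr0 scale1r.
by apply/matrixP => i j; rewrite !mxE MM conjC_conjc.
Qed.

Lemma Re_mxtrace_calculus n (phi : R -> R) (M : 'M[C]_n) :
  complex.Re (\tr (mx_calculus phi M)) =
  \sum_i phi (complex.Re (spectral_diag M 0 i)).
Proof.
rewrite /mx_calculus mxtrace_mulC mulKVmx ?spectral_unit// mxtrace_diag.
by rewrite raddf_sum/=; apply: eq_bigr => i _; rewrite mxE.
Qed.

Lemma sqmod_unitary n (U : 'M[C]_n) (c : 'cV[C]_n) : U \is unitarymx ->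
  \sum_i sqmod ((U^t* *m c) i 0) = \sum_i sqmod (c i 0).
Proof.
move=> /unitarymxP UU.
have h (u : 'cV[C]_n) : \sum_i sqmod (u i 0) = complex.Re ((u^t* *m u) 0 0).
  rewrite mxE raddf_sum/=; apply: eq_bigr => i _; rewrite !mxE conjC_conjc.
  by case: (u i 0) => a b; rewrite /sqmod/=; ring.
rewrite !h; congr (complex.Re (_ 0 0)).
by rewrite trmx_mul map_mxM/= -/(trmx _) trmxCK mulmxA -(mulmxA _ U) UU mulmx1.
Qed.

(** In the eigenbasis the columns of [G] have nonzero entries only at the indices in [J], so
    [P *m G] factors through dimension [#|J|]. *)
Lemma eigenvalue_count_ge n m (M : 'M[C]_n) (G : 'M[C]_(n, m)) (E : C) :
  M \is hermsymmx -> M *m G = E *: G -> \rank G = m ->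
  (m <= #|[pred i | spectral_diag M 0%R i == E]|)%N.
Proof.
move=> /hermitian_normalmx/orthomx_spectralP ME MG rG.
set P := spectralmx M in ME *; set D := spectral_diag M in ME *.
have uP : P \in unitmx by exact: spectral_unit.
set J := [pred i | _].
pose S : 'M[C]_(n, #|J|) := \matrix_(i, j) (i == enum_val j)%:R.
pose H := P *m G.
have DH i k : D 0 i * H i k = E * H i k.
  have : diag_mx D *m H = E *: H.
    by rewrite /H scalemxAr -MG [in RHS]ME -!mulmxA (mulKVmx uP).
  by move=> /matrixP/(_ i k); rewrite mul_diag_mx !mxE.
have HE : H = S *m \matrix_(j, k) H (enum_val j) k.
  apply/matrixP => i k; rewrite [RHS]mxE.
  have [iJ|iJ] := boolP (i \in J).
    rewrite (bigD1 (enum_rank_in iJ i))//= big1 ?addr0 => [|j ji].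
      by rewrite !mxE enum_rankK_in// eqxx mul1r.
    rewrite !mxE; case: eqP => [ij|_]; last by rewrite mul0r.
    by case/eqP: ji; apply: enum_val_inj; rewrite enum_rankK_in.
  rewrite big1 => [|j _].
    apply/eqP; move: iJ; rewrite inE; apply: contraR => H0; apply/eqP.
    by apply: (mulIf H0); exact: DH.
  rewrite !mxE; case: eqP => [ij|_]; last by rewrite mul0r.
  by move: iJ; rewrite ij enum_valP.
have <- : \rank H = m by rewrite /H eqmxMfull ?row_full_unit.
by rewrite HE (leq_trans (mxrankM_maxl _ _))// rank_leq_col.
Qed.

(** Vanishing on [L] imposes [#|L|] linear conditions on the span of the [#|J|] eigenvectors with
    eigenvalue within [e] of [E]; a larger dimension leaves a nonzero solution. *)
Lemma approximate_eigenvector n (M : 'M[C]_n) (E e : R) (L : {set 'I_n}) :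
  M \is hermsymmx ->
  (#|L| < #|[pred i | `|complex.Re (spectral_diag M 0%R i) - E|%R < e]%R|)%N ->
  exists u : 'cV[C]_n, [/\ u != 0, forall i, i \in L -> u i 0 = 0 &
    \sum_i sqmod ((M *m u - E%:C *: u) i 0) <= e ^+ 2 * \sum_i sqmod (u i 0)].
Proof.
move=> hM; have Dreal := hermitian_spectral_diag_real hM.
have /hermitian_normalmx/orthomx_spectralP ME := hM.
set P := spectralmx M in ME *; set D := spectral_diag M in ME Dreal *.
set J := [pred i | _] => LJ.
have uP : P \is unitarymx by exact: spectral_unitarymx.
pose K : 'M[C]_(#|J|, #|L|) := \matrix_(a, b) (P^t*) (enum_val b) (enum_val a).
have /rowV0Pn[z /sub_kermxP zK z0] : kermx K != 0.
  rewrite kermx_eq0 /row_free; apply/negP => /eqP rK.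
  by have := rank_leq_col K; rewrite rK leqNgt LJ.
(* The solution [z], extended by zero outside [J], gives the coefficients of the sought vector in
   the eigenbasis. *)
pose c : 'cV[C]_n := \col_i \sum_a z 0 a * (i == enum_val a)%:R.
have cJ i : i \notin J -> c i 0 = 0.
  move=> iJ; rewrite mxE big1// => a _; case: eqP => [ia|_]; rewrite ?mulr0//.
  by move: iJ; rewrite ia enum_valP.
have cz a : c (enum_val a) 0 = z 0 a.
  rewrite mxE (bigD1 a)//= eqxx mulr1 big1 ?addr0// => b ba.
  by rewrite (inj_eq enum_val_inj) eq_sym (negPf ba) mulr0.
have c0 : c != 0.
  have /rV0Pn[a za] := z0; apply/eqP => c0; move: za; rewrite -cz c0 mxE.
  by rewrite eqxx.
exists (P^t* *m c); split.
- apply: contra c0 => /eqP Pc; rewrite -[c]mul1mx -(unitarymxP uP) -mulmxA Pc.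
  by rewrite mulmx0.
- move=> i iL; rewrite mxE.
  transitivity ((z *m K) 0 (enum_rank_in iL i)); last by rewrite zK mxE.
  rewrite [RHS]mxE; under eq_bigr do rewrite [c _ _]mxE mulr_sumr.
  rewrite exchange_big/=; apply: eq_bigr => a _.
  rewrite (bigD1 (enum_val a))//= eqxx mulr1 big1 ?addr0 => [|k ka].
    by rewrite [K _ _]mxE enum_rankK_in// mulrC.
  by rewrite (negPf ka) !mulr0.
have -> : M *m (P^t* *m c) - E%:C *: (P^t* *m c) =
    P^t* *m (\col_i ((D 0 i - E%:C) * c i 0)).
  rewrite [in LHS]ME invmx_unitary// -!mulmxA [P *m _]mulmxA (unitarymxP uP) mul1mx.
  rewrite scalemxAr -mulmxBr; congr (_ *m _).
  by apply/colP => i; rewrite mul_diag_mx !mxE mulrBl.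
rewrite !(sqmod_unitary _ uP) mulr_sumr; apply: ler_sum => i _.
rewrite mxE sqmodM; have [iJ|iJ] := boolP (i \in J); last first.
  by rewrite cJ// sqmod0 !mulr0.
apply: ler_wpM2r; first exact: sqmod_ge0.
have : (complex.Re (D 0 i) - E) ^+ 2 <= e ^+ 2.
  move: iJ; rewrite inE => /ltW h.
  by rewrite -real_normK ?num_real// lerXn2r ?nnegrE// (le_trans _ h).
have /mxOverP/(_ 0 i) := Dreal.
case: (D 0 i) => a b; rewrite complex_real/= => /eqP ->.
by rewrite /sqmod/= oppr0 addr0 expr0n addr0.
Qed.

End Spectral.

(** * Cubes and their volume *)

Section Cubes.
Context {R : realType}.

Lemma measurable_tuple_box n (a : 'I_n -> R) (L : R) :
  measurable [set t : n.-tuple R | forall i, a i <= tnth t i < a i + L].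
Proof.
rewrite (_ : [set t | _] = \bigcap_(i in [set: 'I_n])
    ((fun t : n.-tuple R => tnth t i) @^-1` `[a i, a i + L[)); last first.
  apply/seteqP; split => [t ta i _|t ta i] /=; first by rewrite in_itv/= ta.
  by have := ta i Logic.I; rewrite /= in_itv.
apply: fin_bigcap_measurable => [|i _]; first exact: finite_finset.
by rewrite -[X in measurable X]setTI; apply: measurable_tnth.
Qed.

Lemma lebesgue_tuple_box n (a : 'I_n -> R) (L : R) : 0 <= L ->
  @lebesgue_tuple R n [set t : n.-tuple R | forall i, a i <= tnth t i < a i + L]
  = (L ^+ n)%:E.
Proof.
move=> L0; elim: n a => [a|n IH a].
  by rewrite /= diracE mem_set// => -[].
rewrite /= /tcons_measure /pushforward.
rewrite (_ : _ @^-1` _ = `[a ord0, a ord0 + L[%classic `*`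
    [set t : n.-tuple R | forall i, a (lift ord0 i) <= tnth t i < a (lift ord0 i) + L]).
  rewrite product_measure1E//; last exact: measurable_tuple_box.
  rewrite [X in (X * _)%E](lebesgue_measure_itv `[a ord0, a ord0 + L[)/= lte_fin ltrDl.
  have [L_gt0|] := ltP 0 L; last first.
    by move=> L0'; rewrite (_ : L = 0); [|lra]; rewrite exprS mul0r mul0e.
  rewrite [X in (_ * X)%E](IH (fun i : 'I_n => a (lift ord0 i))).
  by rewrite -EFinB addrAC subrr add0r -EFinM -exprS.
apply/seteqP; split => [[x t] /= xt|[x t] /= [x0 xt] i].
  split => [|i]; first by have := xt ord0; rewrite /= in_itv.
  by have := xt (lift ord0 i); rewrite tnthS.
by have [j ->|->] := unliftP ord0 i; [rewrite tnthS|move: x0; rewrite in_itv].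
Qed.

Context {d : nat}.
Local Notation V := 'rV[R]_d.
Implicit Types (a x y : V).

Definition cube a (L : R) : set V := [set x | forall i, a 0 i <= x 0 i < a 0 i + L].

Lemma open_measurable_rV (U : set V) : open U -> measurable (U : set (@borel_rV R d)).
Proof. by move=> oU; apply: sub_sigma_algebra. Qed.

Lemma measurable_cube a (L : R) : measurable (cube a L : set (@borel_rV R d)).
Proof.
have mlt i (c : R) : measurable ([set x : V | x 0 i < c] : set (@borel_rV R d)).
  apply: open_measurable_rV; apply: (@open_comp _ _ (fun x : V => x 0 i) [set z | z < c]).
    by move=> x _; exact: coord_continuous.
  exact: open_lt.
rewrite (_ : cube a L = \bigcap_(i in [set: 'I_d])
    (~` [set x : V | x 0 i < a 0 i] `&` [set x : V | x 0 i < a 0 i + L])); last first.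
  apply/seteqP; split => [x xa i _|x xa i].
    by have /andP[h1 h2] := xa i; split => //=; apply/negP; rewrite -leNgt.
  by have [/negP] := xa i Logic.I; rewrite /= -leNgt => -> ->.
apply: (@fin_bigcap_measurable _ (@borel_rV R d)) => [|i _]; first exact: finite_finset.
by apply: measurableI; [apply: measurableC|]; exact: mlt.
Qed.

Lemma lebesgue_cube a (L : R) : 0 <= L -> @lebesgue_rV R d (cube a L) = (L ^+ d)%:E.
Proof.
move=> L0; rewrite /lebesgue_rV /pushforward -(@lebesgue_tuple_box d (a 0) L L0).
congr (lebesgue_tuple d _); apply/seteqP; split => t /= ta i; have := ta i;
  by rewrite !mxE.
Qed.

Lemma volume_cube a (L : R) : 0 <= L -> volume (cube a L) = L ^+ d.
Proof. by move=> L0; rewrite /volume lebesgue_cube. Qed.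

Lemma open_tube (r : R) (Q : set V) : open (tube r Q).
Proof.
rewrite openE => x [y Qy xy]; apply/nbhs_ballP.
have e0 : 0 < r - enorm (x - y) by rewrite subr_gt0.
exists ((r - enorm (x - y)) / d.+1%:R) => /=; first by rewrite divr_gt0.
move=> z xz; exists y => //; apply: le_lt_trans (enormB_le z x y) _.
rewrite -ltrBrDr.
apply: (@le_lt_trans _ _ (d%:R * ((r - enorm (x - y)) / d.+1%:R))).
  apply: enorm_le_coord => i; rewrite !mxE distrC.
  by case: xz => _ /(_ 0 i); rewrite /ball/= => /ltW.
by rewrite mulrCA gtr_pMr// ltr_pdivrMr// mul1r ltr_nat.
Qed.

(** If [x] lay in the inner cube, a point [y] at distance less than [r] would have all coordinates
    strictly between 0 and [N], hence be interior to the cube. *)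
Lemma tube_cube (r N : R) : 0 < r ->
  tube r (cube 0 N) `<=` cube (const_mx (- r)) (N + 2 * r) `\` cube (const_mx r) (N - 2 * r).
Proof.
move=> r0 x [y [yc yi] xy].
have yN i : 0 <= y 0 i <= N.
  have near e : 0 < e -> exists2 z : V, cube 0 N z & `|y 0 i - z 0 i| < e.
    move=> e0; have [z [Nz [_ /(_ 0 i) yz]]] := yc _ (nbhsx_ballx y e e0).
    by exists z.
  apply/andP; split; apply/ler_addgt0Pr => e /near[z /(_ i)];
    rewrite mxE add0r ltr_norml; lra.
have xyi i : - r < x 0 i - y 0 i < r.
  by rewrite -ltr_norml; have := enorm_coord (x - y) i; rewrite !mxE => /le_lt_trans; apply.
split=> [i|xr].
  by have := yN i; have := xyi i; rewrite !mxE; lra.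
apply: yi; rewrite /interior/=.
have near_y : nbhs y (fun z : V => forall i, 0 < z 0 i /\ z 0 i < N).
  apply: (@filter_forall _ _ (fun i (z : V) => 0 < z 0 i /\ z 0 i < N) (nbhs y)) => i.
  have yi : 0 < y 0 i /\ y 0 i < N.
    by have := xr i; have := xyi i; have := yN i; rewrite !mxE; lra.
  have co := @coord_continuous R 1 d 0 i y.
  apply: filterI; [apply: (co [set t | 0 < t])|apply: (co [set t | t < N])].
    by apply: open_nbhs_nbhs; split; [exact: open_gt|exact: yi.1].
  by apply: open_nbhs_nbhs; split; [exact: open_lt|exact: yi.2].
by apply: filterS near_y => z zi i; have [/ltW z0 zN] := zi i; rewrite mxE add0r z0.
Qed.

Lemma volume_tube_cube (r N : R) : 0 < r -> 2 * r <= N ->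
  volume (tube r (cube 0 N)) <= (N + 2 * r) ^+ d - (N - 2 * r) ^+ d.
Proof.
move=> r0 rN.
pose B1 : set (@borel_rV R d) := cube (const_mx (- r)) (N + 2 * r).
pose B2 : set (@borel_rV R d) := cube (const_mx r) (N - 2 * r).
have [m1 m2] : measurable B1 /\ measurable B2 by split; exact: measurable_cube.
have sub : B2 `<=` B1 by move=> x x2 i; have := x2 i; rewrite !mxE; lra.
have [e1 e2] : @lebesgue_rV R d B1 = ((N + 2 * r) ^+ d)%:E /\
    @lebesgue_rV R d B2 = ((N - 2 * r) ^+ d)%:E.
  by split; apply: lebesgue_cube; lra.
have eD : @lebesgue_rV R d (B1 `\` B2) = ((N + 2 * r) ^+ d - (N - 2 * r) ^+ d)%:E.
  rewrite [LHS](@measureD _ _ _ (@lebesgue_rV R d))// ?[X in (X < _)%E]e1 ?ltry//.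
  rewrite (setIidr sub) EFinB; congr (_ - _)%E; [exact: e1|exact: e2].
rewrite /volume -lee_fin fineK; last first.
  rewrite ge0_fin_numE ?measure_ge0//; apply: (@le_lt_trans _ _ (@lebesgue_rV R d (B1 `\` B2))).
    apply: (@le_measure _ _ _ (@lebesgue_rV R d)); rewrite ?inE.
    - by apply: open_measurable_rV; exact: open_tube.
    - exact: measurableD.
    - exact: tube_cube.
  by rewrite eD ltry.
rewrite -eD; apply: (@le_measure _ _ _ (@lebesgue_rV R d)); rewrite ?inE.
- by apply: open_measurable_rV; exact: open_tube.
- exact: measurableD.
- exact: tube_cube.
Qed.

End Cubes.

(** * The integrated density of states near a point *)

Section VanHove.
Context {R : realType} {d : nat}.

Lemma van_hove_cube (L : R) : 0 < L ->
  van_hove (fun k => cube (0 : 'rV[R]_d) (L * k.+1%:R)).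
Proof.
move=> L0; have N0 k : 0 < L * k.+1%:R by rewrite mulr_gt0.
split.
- move=> k; exists (L * k.+1%:R); split; first exact: num_real.
  move=> c Nc x xN /=; apply: norm_le_coord => [|i]; first by rewrite (le_trans (ltW (N0 k)))// ltW.
  have /andP[] := xN i; rewrite mxE add0r => x0 /ltW xN'.
  by rewrite ger0_norm// (le_trans xN')// ltW.
- by move=> k; exact: measurable_cube.
- by move=> k; rewrite volume_cube ?exprn_gt0// ltW.
(* With [t = k.+1^-1], dividing [volume_tube_cube] by the volume gives the bound [g t], which tends
   to 0 with [t]. *)
- move=> r r0; pose c := 2 * r / L.
  pose g (t : R) := (1 + c * t) ^+ d - (1 - c * t) ^+ d.
  have g0 : g k.+1%:R^-1 @[k --> \oo] --> (0 : R).
    have -> : (0 : R) = (1 + c * 0) ^+ d - (1 - c * 0) ^+ d.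
      by rewrite mulr0 addr0 subr0 subrr.
    have ch : c * k.+1%:R^-1 @[k --> \oo] --> c * (0 : R).
      by apply: cvgM; [exact: cvg_cst|exact: cvg_harmonic].
    apply: cvgB.
      apply: (@continuous_cvg _ _ _ _ _ _ (fun x : R => x ^+ d) (1 + c * 0)).
        exact: exprn_continuous.
      by apply: cvgD => //; exact: cvg_cst.
    apply: (@continuous_cvg _ _ _ _ _ _ (fun x : R => x ^+ d) (1 - c * 0)).
      exact: exprn_continuous.
    by apply: cvgB => //; exact: cvg_cst.
  apply: (@squeeze_cvgr _ _ _ _ (fun=> 0) (fun k => g k.+1%:R^-1)) => //; last exact: cvg_cst.
  exists (Num.truncn (2 * r / L)).+1 => // k /= rk.
  have rN : 2 * r <= L * k.+1%:R.
    rewrite -ler_pdivrMl// mulrC ltW// (lt_le_trans (truncnS_gt _))// ler_nat.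
    exact: leqW.
  have vN : 0 < volume (cube (0 : 'rV[R]_d) (L * k.+1%:R)).
    by rewrite volume_cube ?exprn_gt0// ltW.
  apply/andP; split.
    by rewrite divr_ge0 ?(ltW vN)// /volume fine_ge0// measure_ge0.
  rewrite ler_pdivrMr// volume_cube ?(ltW (N0 k))//.
  apply: le_trans (volume_tube_cube r0 rN) _.
  rewrite /g mulrBl -!exprMn lerB//; rewrite le_eqVlt; apply/orP; left;
    apply/eqP; congr (_ ^+ _); rewrite /c; field; rewrite gt_eqF//=;
    by rewrite gt_eqF ?ltr0Sn.
Qed.

End VanHove.

(** * Tent functions and jumps of a distribution function *)

Section Bump.
Context {R : realType}.
Variable rho : {finite_measure set R -> \bar R}.
Implicit Types (E e x : R) (phi : R -> R) (B : set R).

(** A continuous substitute for the indicator of an interval around [E], admissible as a test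
    function in [integrated_density_of_states]. *)
Definition bump E e x : R := Num.max 0 (1 - `|x - E| / e).

Lemma bump_ge0 E e x : 0 <= bump E e x.
Proof. by rewrite le_max lexx. Qed.

Lemma bump_le1 E e x : 0 < e -> bump E e x <= 1.
Proof. by move=> e0; rewrite ge_max ler01 lerBlDr lerDl divr_ge0// ltW. Qed.

Lemma bump_center E e : bump E e E = 1.
Proof. by rewrite /bump subrr normr0 mul0r subr0; apply/max_idPr. Qed.

Lemma bump_far E e x : 0 < e -> e <= `|x - E| -> bump E e x = 0.
Proof. by move=> e0 ex; apply/max_idPl; rewrite subr_le0 ler_pdivlMr// mul1r. Qed.

Lemma bump_near E e x : 0 < e -> `|x - E| <= e / 2 -> 1 / 2 <= bump E e x.
Proof.
move=> e0 ex; rewrite le_max; apply/orP; right.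
have : `|x - E| / e <= 1 / 2 by rewrite ler_pdivrMr// mulrC mulrA mulr1.
lra.
Qed.

Lemma continuous_bump E e : continuous (bump E e).
Proof.
move=> x; apply: (@continuous_max _ _ (fun=> 0) (fun x => 1 - `|x - E| / e)).
  exact: cvg_cst.
apply: cvgB; first exact: cvg_cst.
apply: cvgM; last exact: cvg_cst.
by apply: cvg_norm; apply: cvgB; [exact: cvg_id|exact: cvg_cst].
Qed.

Lemma bounded_integrable phi B : measurable B -> measurable_fun B phi ->
  (forall x, 0 <= phi x <= 1) -> rho.-integrable B (EFin \o phi).
Proof.
move=> mB mphi phi01; apply: measurable_bounded_integrable => //.
  by rewrite -ge0_fin_numE// fin_num_measure.
exists 1; split; first exact: num_real.
move=> c c1 x _ /=; have /andP[phi0 phi1] := phi01 x.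
by rewrite ger0_norm// (le_trans phi1)// ltW.
Qed.

Lemma Rintegral_le_measure phi B : measurable B -> measurable_fun setT phi ->
  (forall x, 0 <= phi x <= 1) -> (forall x, ~ B x -> phi x = 0) ->
  Rintegral rho setT phi <= fine (rho B).
Proof.
move=> mB mphi phi01 phi0.
have -> : phi = phi \_ B.
  by apply/funext => x; rewrite patchE; case: ifPn => //; rewrite notin_setE => /phi0.
rewrite -Rintegral_mkcond -[leRHS]mul1r -Rintegral_cst//.
apply: le_Rintegral => //.
- by apply: bounded_integrable => //; exact: measurable_funS mphi.
- by apply: (@bounded_integrable (fun=> 1)) => // x; rewrite ler01 lexx.
- by move=> x _; have /andP[] := phi01 x.
Qed.

Lemma measure_le_Rintegral phi B (c : R) : measurable B -> measurable_fun setT phi ->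
  (forall x, 0 <= phi x <= 1) -> 0 <= c <= 1 -> (forall x, B x -> c <= phi x) ->
  c * fine (rho B) <= Rintegral rho setT phi.
Proof.
move=> mB mphi phi01 c01 cphi; rewrite -Rintegral_cst//.
have mphiB : measurable_fun B phi by exact: measurable_funS mphi.
apply: (@le_trans _ _ (Rintegral rho B phi)).
  apply: le_Rintegral => //; last exact: bounded_integrable.
  exact: (@bounded_integrable (fun=> c)).
rewrite Rintegral_mkcond; apply: le_Rintegral => //.
- apply: bounded_integrable => //; first by apply/(measurable_restrictT phi mB).
  by move=> x; rewrite patchE; case: ifP => // _; rewrite lexx ler01.
- exact: bounded_integrable.
- by move=> x _; rewrite patchE; case: ifP => // _; have /andP[] := phi01 x.
Qed.

Lemma bump01 E e x : 0 < e -> 0 <= bump E e x <= 1.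
Proof. by move=> e0; rewrite bump_ge0 bump_le1. Qed.

Lemma measurable_bump E e : measurable_fun setT (bump E e).
Proof. by apply: continuous_measurable_fun; exact: continuous_bump. Qed.

Lemma distribution_function_itv (a b : R) : a <= b ->
  fine (rho `]a, b]%classic) = distribution_function rho b - distribution_function rho a.
Proof.
move=> ab; have fin (B : set R) : measurable B -> rho B \is a fin_num.
  by move=> mB; rewrite fin_num_measure.
rewrite /distribution_function.
rewrite (_ : `]-oo, b]%classic = `]-oo, a]%classic `|` `]a, b]%classic); last first.
  by rewrite -itv_bndbnd_setU// bnd_simp.
rewrite measureU//; last first.
  apply/seteqP; split => x //=; rewrite !in_itv/= => -[xa /andP[ax _]].
  by move: xa; rewrite leNgt ax.
by rewrite fineD ?fin// addrAC subrr add0r.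
Qed.

Lemma continuous_of_bump E :
  (forall c : R, 0 < c -> exists2 e : R, 0 < e & Rintegral rho setT (bump E e) <= c) ->
  {for E, continuous (distribution_function rho)}.
Proof.
move=> small; apply/cvgrPdist_le => c c0.
(* [bump] is only known to be at least 1/2 on the half interval, which costs a factor 2. *)
have c20 : 0 < c / 2 by rewrite divr_gt0.
have [e e0 ec] := small _ c20.
have e20 : 0 < e / 2 by rewrite divr_gt0.
have mass a b : `|a - E| <= e / 2 -> `|b - E| <= e / 2 -> a <= b ->
    distribution_function rho b - distribution_function rho a <= c.
  move=> aE bE ab; rewrite -distribution_function_itv//.
  suff : 1 / 2 * fine (rho `]a, b]%classic) <= Rintegral rho setT (bump E e) by lra.
  apply: measure_le_Rintegral => //.
  - exact: measurable_bump.
  - by move=> x; exact: bump01.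
  - by apply/andP; split; lra.
  - move=> x /=; rewrite in_itv/= => /andP[ax xb]; apply: bump_near => //.
    by move: aE bE; rewrite !ler_norml; lra.
have mono a b : a <= b -> distribution_function rho a <= distribution_function rho b.
  by move=> ab; rewrite -subr_ge0 -distribution_function_itv// fine_ge0.
exists (e / 2) => //= x; rewrite /= => /ltW xE.
have EE : `|E - E| <= e / 2 by rewrite subrr normr0 ltW.
have xE' : `|x - E| <= e / 2 by rewrite distrC.
have [Ex|/ltW xE2] := leP E x.
  by rewrite distrC ger0_norm ?subr_ge0 ?mono// mass.
by rewrite ger0_norm ?subr_ge0 ?mono// mass.
Qed.

(** Continuity at [E] would make the mass of []E - e / 2, E + e / 2]] smaller than [c], and this
    interval contains the support of [bump E (e / 3)]. *)
Lemma discontinuous_of_bump E (c : R) : 0 < c ->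
  (forall e, 0 < e -> c <= Rintegral rho setT (bump E e)) ->
  ~ {for E, continuous (distribution_function rho)}.
Proof.
move=> c0 large; have c20 : 0 < c / 2 by rewrite divr_gt0.
move=> /cvgrPdist_lt/(_ _ c20)[e /= e0 near].
have e30 : 0 < e / 3 by rewrite divr_gt0.
have := large _ e30; apply/negP; rewrite -ltNge.
apply: (@le_lt_trans _ _ (fine (rho `]E - e / 2, E + e / 2]%classic))).
  apply: Rintegral_le_measure => //; first exact: measurable_bump.
    by move=> x; exact: bump01.
  move=> x /= nx; apply: bump_far => //; rewrite leNgt; apply/negP => xE; apply: nx.
  by move: xE; rewrite in_itv/= ltr_norml; lra.
rewrite distribution_function_itv; last lra.
have h y : `|E - y| < e ->
    `|distribution_function rho E - distribution_function rho y| < c / 2 := near y.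
have h1 : `|E - (E - e / 2)| < e by rewrite opprB addrCA subrr addr0 ger0_norm; lra.
have h2 : `|E - (E + e / 2)| < e.
  by rewrite opprD addrA subrr add0r normrN ger0_norm; lra.
by move: (h _ h1) (h _ h2); rewrite !ltr_norml; lra.
Qed.

End Bump.

(** * Lower bound on the number of eigenvalues *)

Section Counting.
Local Open Scope nat_scope.

Lemma card_ffun_coord (T : finType) d (P : pred T) (j : 'I_d) :
  #|[pred z : {ffun 'I_d -> T} | P (z j)]| = #|P| * #|T| ^ d.-1.
Proof.
pose F (i : 'I_d) (t : T) : nat := if i == j then P t : nat else 1.
have sumP : \sum_t F j t = #|P|.
  rewrite /F eqxx -sum1_card [RHS]big_mkcond/=; apply: eq_bigr => t _.
  by rewrite -[t \in P]/(P t); case: (P t).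
transitivity (\prod_i \sum_t F i t).
  rewrite bigA_distr_bigA -sum1_card [LHS]big_mkcond/=; apply: eq_bigr => z _.
  rewrite (bigD1 j)//= big1 => [|i ij]; last by rewrite /F (negPf ij).
  by rewrite /F eqxx muln1 inE; case: (P _).
rewrite (bigD1 j)//= sumP; congr (_ * _).
rewrite (eq_bigr (fun=> #|T|)) => [|i ij].
  by rewrite (eq_bigl [in predC1 j])// prod_nat_const cardC1 card_ord.
by rewrite /F (negPf ij) sum1_card.
Qed.

Lemma card_exists_coord (T : finType) d (P : pred T) :
  #|[pred z : {ffun 'I_d -> T} | [exists j, P (z j)]]| <= d * (#|P| * #|T| ^ d.-1).
Proof.
have -> : d * (#|P| * #|T| ^ d.-1) =
    \sum_(j < d) #|[pred z : {ffun 'I_d -> T} | P (z j)]|.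
  rewrite (eq_bigr (fun=> #|P| * #|T| ^ d.-1)) => [|j _]; last exact: card_ffun_coord.
  by rewrite sum_nat_const card_ord.
under [leqRHS]eq_bigr do rewrite -sum1_card big_mkcond/=.
rewrite exchange_big/= -sum1_card big_mkcond/=; apply: leq_sum => z _.
rewrite inE; case: existsP => // -[j Pj].
by rewrite (bigD1 j)//= inE Pj.
Qed.

Definition near_end (m N b : nat) := (b < m) || (N - m <= b).

Lemma card_near_end m N : 0 < m ->
  #|[pred b : 'I_N | near_end m N b]| <= 2 * m.
Proof.
case: m => // m _.
(* An index is recorded by the end it is close to and its distance from that end. *)
pose g (b : 'I_N) : bool * 'I_m.+1 :=
  (b < m.+1, inord (if b < m.+1 then b : nat else N.-1 - b)).
have -> : 2 * m.+1 = #|{: bool * 'I_m.+1}| by rewrite card_prod card_bool card_ord.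
apply: (leq_card_in g) => a b; rewrite !inE /near_end => Pa Pb [].
have aN := ltn_ord a; have bN := ltn_ord b.
case: ltnP Pa => am Pa; case: ltnP Pb => bm Pb // _ /(congr1 (@nat_of_ord _)).
  by rewrite !inordK// => ab; exact: val_inj.
have [a' b'] : N.-1 - a < m.+1 /\ N.-1 - b < m.+1 by move: Pa Pb => /=; lia.
by rewrite !inordK// => ab; apply: val_inj => /=; lia.
Qed.

End Counting.

Section Density.
Context {R : realType} {d : nat}.
Local Notation V := 'rV[R]_d.
Local Notation C := R[i].
Implicit Types (w : closed_set R d) (x y p : V) (f : V -> C).
Variables (Omega : set (closed_set R d)) (A : closed_set R d -> @operator R d).
Hypothesis ddsf : is_ddsf Omega.
Hypothesis boundedA : forall w, Omega w -> bounded_operator w (A w).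
Hypothesis selfadjointA : forall w, Omega w -> selfadjoint_operator w (A w).

Lemma finite_cube w a (L : R) : Omega w -> finite_set (cube a L `&` closed_set_val w).
Proof.
move=> Ow; apply: sub_finite_set (dds_finite ddsf a (d%:R * L) Ow).
move=> x [xa wx]; split => //; rewrite /cball/= enormC.
by apply: enorm_le_coord => i; rewrite !mxE ger0_norm; have := xa i; lra.
Qed.

Lemma restriction_hermsymmx w (s : seq V) : Omega w ->
  (forall x, x \in s -> closed_set_val w x) -> restriction (A w) s \is hermsymmx.
Proof.
move=> Ow sw; apply: hermsymmxP => i j; rewrite !mxE.
by apply: (matrix_element_herm (boundedA Ow) (selfadjointA Ow)); apply: sw; rewrite mem_nth.
Qed.

Lemma restriction_mulmx w (s : seq V) f m (G : 'M[C]_(size s, m)) (j : 'I_m) i :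
  Omega w -> uniq s -> (forall x, x \in s -> closed_set_val w x) ->
  (forall x, f x <> 0 -> x \in s) -> (forall k : 'I_(size s), G k j = f s`_k) ->
  (restriction (A w) s *m G) i j = A w f s`_i.
Proof.
move=> Ow us sw fs Gf; rewrite (operatorE _ (boundedA Ow) us sw fs) mxE.
by rewrite (big_nth 0) big_mkord; apply: eq_bigr => k _; rewrite mxE Gf.
Qed.

Lemma local_dosE w (Q : set V) (phi : R -> R) :
  local_dos w (A w) Q phi = (volume Q)^-1 *
  \sum_i phi (complex.Re (spectral_diag (restriction (A w) (pts (Q `&` w))) 0 i)).
Proof. by rewrite /local_dos Re_mxtrace_calculus. Qed.

Lemma local_dos_le w (Q : set V) (E e : R) : 0 < e -> 0 <= volume Q ->
  local_dos w (A w) Q (bump E e) <= (volume Q)^-1 *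
  #|[pred i | `|complex.Re (spectral_diag (restriction (A w) (pts (Q `&` w))) 0 i)
      - E| < e]|%:R.
Proof.
move=> e0 Q0; rewrite local_dosE ler_wpM2l ?invr_ge0//.
rewrite -sum1_card natr_sum [leRHS]big_mkcond/=; apply: ler_sum => i _.
by rewrite inE; case: ltP => ie; [exact: bump_le1|rewrite bump_far].
Qed.

Lemma local_dos_ge w (Q : set V) (E e : R) : 0 < e -> 0 <= volume Q ->
  (volume Q)^-1 *
  #|[pred i | spectral_diag (restriction (A w) (pts (Q `&` w))) 0 i == E%:C]|%:R <=
  local_dos w (A w) Q (bump E e).
Proof.
move=> e0 Q0; rewrite local_dosE ler_wpM2l ?invr_ge0//.
rewrite -sum1_card natr_sum [leLHS]big_mkcond/=; apply: ler_sum => i _.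
by rewrite inE; case: eqP => [->|_]; [rewrite bump_center|exact: bump_ge0].
Qed.

(** Each of the [k.+1 ^ d] cells of side [2 * S + 1] carries an eigenfunction centered at its
    middle; the extra 1 keeps the support strictly inside, so supports in different cells are
    disjoint. *)
Lemma local_dos_bump_ge w (E S e : R) (k : nat) : Omega w -> 0 < S -> 0 < e ->
  (forall x, exists2 f, locally_supported_eigenfunction w (A w) E f &
    forall y, f y <> 0 -> enorm (y - x) <= S) ->
  ((2 * S + 1) ^+ d)^-1 <=
  local_dos w (A w) (cube 0 ((2 * S + 1) * k.+1%:R)) (bump E e).
Proof.
move=> Ow S0 e0 eig; set L := 2 * S + 1; have L0 : 0 < L by rewrite /L; lra.
set Q := cube _ _; have vQ : volume Q = (L * k.+1%:R) ^+ d.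
  by rewrite volume_cube// mulr_ge0// ltW.
have vQ0 : 0 < volume Q by rewrite vQ exprn_gt0// mulr_gt0.
apply: le_trans (local_dos_ge w E e0 (ltW vQ0)).
pose s := pts (Q `&` w); have us : uniq s by exact: pts_uniq.
have fQ : finite_set (Q `&` w) by exact: finite_cube.
have sw x : x \in s -> closed_set_val w x by move=> /(ptsP _ fQ)[].
pose cell := {ffun 'I_d -> 'I_k.+1}.
pose center (c : cell) : V := \row_i (L * (c i)%:R + L / 2).
have /choice[F FP] : forall c, exists f, locally_supported_eigenfunction w (A w) E f /\
    forall y, f y <> 0 -> enorm (y - center c) <= S.
  by move=> c; have [f lf fS] := eig (center c); exists f.
have Fcell c y : F c y <> 0 -> forall i, L * (c i)%:R < y 0 i < L * (c i).+1%:R.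
  move=> /(FP c).2 yS i; have := le_trans (enorm_coord _ i) yS.
  by rewrite !mxE ler_norml -[(c i).+1%:R]natr1 mulrDr mulr1 /L; lra.
have Fs c y : F c y <> 0 -> y \in s.
  move=> Fy; apply/(ptsP _ fQ); split; last first.
    by apply: contrapT => wy; have [[l2 _] _ _ _] := (FP c).1; apply: Fy; exact: l2.
  move=> i; rewrite mxE add0r; have /andP[h1 h2] := Fcell _ _ Fy i.
  rewrite (le_trans _ (ltW h1)) ?mulr_ge0 ?(ltW L0)//=.
  by rewrite (lt_le_trans h2)// ler_pM2l// ler_nat ltn_ord.
have Fdisj c c' y : F c y <> 0 -> F c' y <> 0 -> c = c'.
  move=> /Fcell yc /Fcell yc'; apply/ffunP => i; apply: val_inj => /=.
  have /andP[a1 a2] := yc i; have /andP[b1 b2] := yc' i.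
  have := lt_trans a1 b2; have := lt_trans b1 a2.
  by rewrite !ltr_pM2l// !ltr_nat !ltnS => ? ?; apply/eqP; rewrite eqn_leq; apply/andP.
pose G : 'M[C]_(size s, #|{: cell}|) := \matrix_(i, j) F (enum_val j) s`_i.
have MG : restriction (A w) s *m G = E%:C *: G.
  apply/matrixP => i j; rewrite (@restriction_mulmx w s (F (enum_val j)))//; last 2 first.
  - by move=> x; exact: Fs.
  - by move=> l; rewrite mxE.
  by have [_ _ -> _] := (FP (enum_val j)).1; rewrite !mxE.
have rG : \rank G = #|{: cell}|.
  rewrite -mxrank_tr; apply/eqP; rewrite -/(row_free _) -kermx_eq0; apply/rowV0P => z.
  move=> /sub_kermxP zG; apply/rowP => j; rewrite mxE.
  (* At a point where the function of cell [j] is nonzero, all others vanish, so the relation [zG]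
     isolates the coefficient [z 0 j]. *)
  have [x Fx] : exists x, F (enum_val j) x <> 0.
    apply: contrapT => h; have [_ Fn0 _ _] := (FP (enum_val j)).1; apply: Fn0.
    by apply/funext => x; apply: contrapT => Fx; apply: h; exists x.
  have hx : (index x s < size s)%N by rewrite index_mem; exact: Fs Fx.
  have := congr1 (fun B : 'M[C]_(1, size s) => B 0 (Ordinal hx)) zG.
  rewrite !mxE (bigD1 j)//= big1 ?addr0 => [|l lj].
    rewrite !mxE /= nth_index ?(Fs _ _ Fx)// => /eqP.
    by rewrite mulf_eq0 => /orP[/eqP//|/eqP].
  rewrite !mxE /= nth_index ?(Fs _ _ Fx)//.
  have -> : F (enum_val l) x = 0; last by rewrite mulr0.
  apply: contrapT => Fl; case/eqP: lj; apply: enum_val_inj; exact: Fdisj Fl Fx.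
have := eigenvalue_count_ge (restriction_hermsymmx Ow sw) MG rG.
rewrite card_ffun !card_ord => kd.
rewrite -(ler_pM2l vQ0) mulrA divff ?gt_eqF// mul1r vQ exprMn mulrAC divff ?mul1r.
  by rewrite -natrX ler_nat.
by rewrite expf_neq0// gt_eqF.
Qed.

End Density.

(** * Upper bound on the number of eigenvalues *)

Section UpperBound.
Context {R : realType} {d : nat}.
Local Notation V := 'rV[R]_d.
Local Notation C := R[i].
Implicit Types (x y p : V) (f : V -> C).
Variables (Omega : set (closed_set R d)) (A : closed_set R d -> @operator R d).
Hypothesis ddsf : is_ddsf Omega.
Hypothesis boundedA : forall w, Omega w -> bounded_operator w (A w).
Hypothesis selfadjointA : forall w, Omega w -> selfadjoint_operator w (A w).
Variable r : R.
Hypothesis r_gt0 : 0 < r.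
Hypothesis rangeA : finite_range Omega A r.
Variables (w : closed_set R d) (E : R).
Hypothesis Ow : Omega w.
Variables (sep : R) (m N k : nat).
Hypothesis sep_gt0 : 0 < sep.
Hypothesis sepw : separated sep w.

(* [w] meets each cell of the grid of mesh [h] at most once; the cube is divided
   into [k.+1 ^ d] blocks of side [N.+1] cells, and [rim y] says that [y] is
   within [m] cells of the boundary of its block. *)
Let h := sep / d.+1%:R.
Hypothesis rm : r <= h * m%:R.
Let L := h * N.+1%:R.
Let Q : set V := cube 0 (L * k.+1%:R).
Let s := pts (Q `&` w).
Let block x : {ffun 'I_d -> 'I_k.+1} := [ffun j => inord (grid 0 h x j %/ N.+1)].
Let rim y := [exists j : 'I_d, near_end m N.+1 (grid 0 h y j %% N.+1)].

Let h_gt0 : 0 < h. Proof. by rewrite divr_gt0. Qed.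
Let L_gt0 : 0 < L. Proof. by rewrite mulr_gt0. Qed.
Let fQ : finite_set (Q `&` w). Proof. exact: (finite_cube ddsf). Qed.
Let us : uniq s. Proof. exact: pts_uniq. Qed.
Let sw x : x \in s -> closed_set_val w x. Proof. by move=> /(ptsP _ fQ)[]. Qed.
Let sQ x : x \in s -> Q x. Proof. by move=> /(ptsP _ fQ)[]. Qed.

Let grid_bounds x j : Q x -> (grid 0 h x j)%:R * h <= x 0 j < (grid 0 h x j).+1%:R * h.
Proof.
move=> /(_ j); rewrite mxE add0r => /andP[x0 _].
rewrite -ler_pdivlMr// -ltr_pdivrMr// /grid mxE subr0.
by apply: truncn_itv; rewrite divr_ge0// ltW.
Qed.

Let grid_lt x j : Q x -> (grid 0 h x j < k.+1 * N.+1)%N.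
Proof.
move=> Qx; have /andP[h1 _] := grid_bounds j Qx.
have /andP[_] := Qx j; rewrite mxE add0r => /(le_lt_trans h1).
by rewrite /L mulrC -mulrA ltr_pM2l// -natrM ltr_nat mulnC.
Qed.

Let block_val x j : Q x -> block x j = (grid 0 h x j %/ N.+1)%N :> nat.
Proof. by move=> Qx; rewrite ffunE inordK// ltn_divLR// grid_lt. Qed.

(** Off the rim, [y] is at least [m] cells, hence by [rm] at least [r], away from the faces of its
    block. *)
Let same_block_or_rim x y : closed_set_val w x -> y \in s -> enorm (x - y) < r ->
  ~~ rim y -> (x \in s) && (block x == block y).
Proof.
move=> wx ys xy /existsPn nrim; have Qy := sQ ys.
have xyr j : - r < x 0 j - y 0 j < r.
  by rewrite -ltr_norml; have := enorm_coord (x - y) j; rewrite !mxE => /le_lt_trans; apply.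
pose a j := (grid 0 h y j %/ N.+1)%N.
have aK j : (a j < k.+1)%N by rewrite ltn_divLR// grid_lt.
have xa j : (a j * N.+1)%:R * h <= x 0 j < ((a j).+1 * N.+1)%:R * h.
  have := nrim j; rewrite /near_end negb_or -leqNgt -ltnNge => /andP[b1 b2].
  have := grid_bounds j Qy; rewrite (divn_eq (grid 0 h y j) N.+1) -/(a j).
  move: (grid 0 h y j %% N.+1)%N b1 b2 => b b1 b2.
  have c1 : (a j * N.+1 + m)%:R * h <= (a j * N.+1 + b)%:R * h.
    by rewrite ler_pM2r// ler_nat leq_add2l.
  have c2 : (a j * N.+1 + b).+1%:R * h + m%:R * h <= ((a j).+1 * N.+1)%:R * h.
    by rewrite -mulrDl ler_pM2r// -natrD ler_nat mulSn; lia.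
  have := xyr j; move: rm c1; rewrite natrD mulrDl; move: c2; lra.
have Qx : Q x.
  move=> j; rewrite mxE add0r; have /andP[x1 x2] := xa j.
  rewrite (le_trans (mulr_ge0 (ler0n _ _) (ltW h_gt0)) x1)/=.
  apply: lt_le_trans x2 _; rewrite /L -mulrA -natrM mulrC ler_pM2l// ler_nat.
  by rewrite mulnC leq_mul2l aK orbT.
apply/andP; split; first by apply/(ptsP _ fQ).
apply/eqP/ffunP => j; apply: val_inj; rewrite /= !block_val// -/(a j).
have /andP[x1 x2] := xa j; have /andP[g1 g2] := grid_bounds j Qx.
have := le_lt_trans g1 x2; have := le_lt_trans x1 g2.
rewrite !ltr_pM2r// !ltr_nat ltnS => i1 i2.
by apply/eqP; rewrite eqn_leq -ltnS ltn_divLR// i2 leq_divRL.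
Qed.

Let card_rim :
  (#|[pred i : 'I_(size s) | rim (s`_i)%R]| <=
   d * ((2 * m * k.+1) * (k.+1 * N.+1) ^ d.-1))%N.
Proof.
have m_gt0 : (0 < m)%N.
  by rewrite -(ltr_nat R) -(pmulr_rgt0 _ h_gt0) (lt_le_trans r_gt0).
(* In each coordinate: the block, and the cell inside the block. Together they determine the grid
   cell, hence by separation the point. A rim point has, in some coordinate, at most [2 * m * k.+1]
   such pairs to choose from. *)
pose idx (i : 'I_(size s)) : {ffun 'I_d -> 'I_k.+1 * 'I_N.+1} :=
  [ffun j => (block s`_i j, inord (grid 0 h s`_i j %% N.+1))].
have sn (i : 'I_(size s)) : s`_i \in s by rewrite mem_nth.
pose P (t : 'I_k.+1 * 'I_N.+1) := near_end m N.+1 t.2.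
have idx_inj : injective idx.
  move=> i j /ffunP ij; apply: val_inj; apply/eqP.
  rewrite -(nth_uniq 0 (ltn_ord i) (ltn_ord j) us); apply/eqP.
  have Q0 (l : 'I_(size s)) c : (0 : V) 0 c <= s`_l 0 c by have /andP[] := sQ (sn l) c.
  apply: (grid_inj sep_gt0 sepw) (sw (sn i)) (sw (sn j)) (Q0 i) (Q0 j) _ => c.
  have := ij c; rewrite !ffunE => -[] /(congr1 (@nat_of_ord _)) + /(congr1 (@nat_of_ord _)).
  rewrite !inordK ?ltn_pmod ?ltn_divLR ?grid_lt//; try exact: sQ.
  by rewrite -/h => e1 e2; rewrite (divn_eq (grid 0 h s`_i c) N.+1) e1 e2 -divn_eq.
have cP : (#|P| <= 2 * m * k.+1)%N.
  have -> : #|P| = #|[predX 'I_k.+1 & [pred b : 'I_N.+1 | near_end m N.+1 b]]|.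
    by apply: eq_card => t; rewrite !inE.
  by rewrite cardX card_ord mulnC leq_mul2r card_near_end ?orbT.
apply: (@leq_trans #|[pred z : {ffun 'I_d -> 'I_k.+1 * 'I_N.+1} | [exists j, P (z j)]]|).
  rewrite -(fintype.card_image idx_inj); apply: subset_leq_card; apply/fintype.subsetP => z.
  case/seq.mapP => i; rewrite mem_enum inE => /existsP[j nj] ->.
  rewrite inE; apply/existsP; exists j.
  by rewrite /P ffunE/= inordK// ltn_pmod.
apply: leq_trans (card_exists_coord _ _) _.
by rewrite card_prod !card_ord leq_mul2l leq_mul2r cP !orbT.
Qed.

(** For [f] vanishing on the rim, cutting off to a block commutes with [A w - E]: a matrix element
    linking different blocks, or a block with the outside of [Q], is zero or meets a rim point. *)
Let operator_block f (c : {ffun 'I_d -> 'I_k.+1}) :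
  (forall x, f x <> 0 -> x \in s) -> (forall x, rim x -> f x = 0) ->
  let fc x := if (x \in s) && (block x == c) then f x else 0 in
  forall x, A w fc x - E%:C * fc x =
    if (x \in s) && (block x == c) then A w f x - E%:C * f x else 0.
Proof.
move=> fs frim fc x.
have fcs y : fc y <> 0 -> y \in s by rewrite /fc; case: ifP => // /andP[].
have [wx|nwx] := pselect (closed_set_val w x); last first.
  have xs : x \in s = false by apply/negP => /sw.
  have l2 : ell2 w fc.
    by apply: (@ell2_finite _ _ _ [set` s]) => //; exact: finite_seq.
  by rewrite /fc xs/= mulr0 subr0; have [->] := operator_ell2 (boundedA Ow) l2.
have term y : y \in s -> block y != c \/ ~~ ((x \in s) && (block x == c)) ->
    (x \in s) && (block x == c) != (block y == c) ->
    matrix_element (A w) x y * f y = 0.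
  move=> ys _ xy; have [rxy|rxy] := leP r (enorm (x - y)).
    by rewrite rangeA.1 ?mul0r//; exact: sw.
  have [/frim -> |nrim] := boolP (rim y); first by rewrite mulr0.
  have /andP[xs /eqP bxy] := same_block_or_rim wx ys rxy nrim.
  by move: xy; rewrite xs bxy/= eqxx.
rewrite (operatorE x (boundedA Ow) us sw fcs).
case: ifPn => xc.
  rewrite (operatorE x (boundedA Ow) us sw fs) /fc xc; congr (_ - _).
  rewrite [LHS]big_seq [RHS]big_seq; apply: eq_bigr => y ys; rewrite ys/=.
  have [//|yc] := boolP (block y == c).
  by rewrite mulr0 term//; [left|rewrite xc (negPf yc)].
rewrite {2}/fc (negPf xc) mulr0 subr0 big_seq big1// => y ys; rewrite /fc ys/=.
have [yc|_] := boolP (block y == c); last by rewrite mulr0.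
by rewrite term//; [right|rewrite (negPf xc) yc].
Qed.

Let block_diam x y : x \in s -> y \in s -> block x = block y ->
  enorm (x - y) <= d%:R * L.
Proof.
move=> /sQ Qx /sQ Qy /ffunP bxy; apply: enorm_le_coord => j.
have b z : Q z -> (block z j * N.+1)%:R * h <= z 0 j < ((block z j).+1 * N.+1)%:R * h.
  move=> Qz; have /andP[z1 z2] := grid_bounds j Qz; rewrite block_val//.
  rewrite (le_trans _ z1) ?ler_pM2r ?ler_nat ?leq_divM//=.
  by rewrite (lt_le_trans z2)// ler_pM2r// ler_nat ltn_ceil.
have /andP[x1 x2] := b x Qx; have /andP[y1 y2] := b y Qy.
move: x1 x2 y1 y2; rewrite bxy mulSn natrD mulrDl [N.+1%:R * h]mulrC -/L.
by rewrite !mxE ler_norml; lra.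
Qed.

(** More eigenvalues than rim points would give an approximate eigenvector [f] vanishing on the rim;
    summing the lower bound [e0] over the blocks contradicts the upper bound [e ^+ 2]. *)
Lemma card_near_eigenvalues (e0 e : R) : e ^+ 2 < e0 ->
  (forall p f, closed_set_val w p ->
    (forall x, f x <> 0 -> closed_set_val w x /\ enorm (x - p) <= d%:R * L) ->
    e0 * nsq f <= nsq (fun x => A w f x - E%:C * f x)) ->
  (#|[pred i | `|complex.Re (spectral_diag (restriction (A w) s) 0%R i) - E|%R < e]%R|
   <= d * ((2 * m * k.+1) * (k.+1 * N.+1) ^ d.-1))%N.
Proof.
move=> ee0 coer; apply: leq_trans _ card_rim; rewrite leqNgt; apply/negP => lt.
pose rims : {set 'I_(size s)} := finset (fun i : 'I_(size s) => rim s`_i).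
have /(approximate_eigenvector (restriction_hermsymmx boundedA selfadjointA Ow sw)) :
    (#|rims| < #|[pred i | `|complex.Re (spectral_diag (restriction (A w) s) 0%R i)
      - E|%R < e]%R|)%N by rewrite cardsE.
move=> [u [u0 urim uE]].
pose f := extend (fun i : 'I_(size s) => u i 0).
have fE (i : 'I_(size s)) : f s`_i = u i 0 by rewrite /f extendE.
have fs x : f x <> 0 -> x \in s by exact: extend_supp.
have sidx x : x \in s -> exists i : 'I_(size s), x = s`_i.
  move=> xs; have hx : (index x s < size s)%N by rewrite index_mem.
  by exists (Ordinal hx); rewrite /= nth_index.
have frim x : rim x -> f x = 0.
  move=> rx; apply: contrapT => fx; have [i xi] := sidx _ (fs _ fx).
  by apply: fx; rewrite xi fE urim// inE -xi.
pose g x := A w f x - E%:C * f x.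
have sum_u (F : V -> R) : \sum_(x <- s) F x = \sum_(i < size s) F s`_i.
  by rewrite (big_nth 0) big_mkord.
have uE' : \sum_(x <- s) sqmod (g x) <= e ^+ 2 * \sum_(x <- s) sqmod (f x).
  rewrite !sum_u (le_trans _ (le_trans uE _))//; last first.
    by under [in leRHS]eq_bigr do rewrite fE.
  apply: ler_sum => i _; rewrite !mxE.
  have uf (l : 'I_(size s)) : u l 0 = f s`_l by rewrite fE.
  have := @restriction_mulmx _ _ _ _ boundedA w s f 1 u 0 i Ow us sw fs uf.
  by rewrite mxE => ->; rewrite /g fE.
have f0 : 0 < \sum_(x <- s) sqmod (f x).
  rewrite sum_u lt0r sumr_ge0 ?andbT => [|i _]; last exact: sqmod_ge0.
  apply: contra u0 => /eqP S0; apply/eqP/colP => i; rewrite mxE -fE; apply: sqmod_eq0.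
  by apply: (psumr_eq0P _ S0) => // j _; exact: sqmod_ge0.
suff : e0 * \sum_(x <- s) sqmod (f x) <= \sum_(x <- s) sqmod (g x).
  move=> /le_trans/(_ uE'); rewrite ler_pM2r//; apply/negP; by rewrite -ltNge.
rewrite (partition_big block xpredT)//= [leRHS](partition_big block xpredT)//=.
rewrite mulr_sumr; apply: ler_sum => c _.
pose fc x := if (x \in s) && (block x == c) then f x else 0.
have fcs x : fc x <> 0 -> (x \in s) && (block x == c) by rewrite /fc; case: ifP.
have gc := operator_block c fs frim.
have e1 : nsq fc = \sum_(x <- s | block x == c) sqmod (f x).
  rewrite (nsqE us) => [|x /fcs/andP[]//]; rewrite [RHS]big_mkcond/=.
  rewrite [LHS]big_seq [RHS]big_seq; apply: eq_bigr => x xs; rewrite /fc xs/=.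
  by case: ifP => //; rewrite sqmod0.
have e2 : nsq (fun x => A w fc x - E%:C * fc x) = \sum_(x <- s | block x == c) sqmod (g x).
  rewrite (nsqE us) => [|x]; last by rewrite gc; case: ifP => // /andP[].
  rewrite [RHS]big_mkcond/= [LHS]big_seq [RHS]big_seq; apply: eq_bigr => x xs.
  by rewrite gc xs/=; case: ifP => //; rewrite sqmod0.
(* Any support point of the block can serve as center [p], since [d * L] bounds the diameter of a
   block. *)
rewrite -e1 -e2; have [[p fp]|nofc] := pselect (exists p, fc p <> 0).
  have /andP[ps /eqP bp] := fcs _ fp.
  apply: (coer p); first exact: sw.
  by move=> x /fcs/andP[xs /eqP bx]; split; [exact: sw|apply: block_diam => //; rewrite bx].
have -> : nsq fc = 0.
  by rewrite (@nsqE _ _ [::]) ?big_nil// => x fx; case: nofc; exists x.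
by rewrite mulr0 e2 sumr_ge0// => x _; exact: sqmod_ge0.
Qed.

End UpperBound.

(** * Proof of the theorem *)

Section Main.
Context {R : realType} {d : nat}.
Variables (Omega : set (closed_set R d)) (A : closed_set R d -> @operator R d).
Hypothesis ddsf : is_ddsf Omega.
Hypothesis randomA : selfadjoint_random_operator Omega A.

(** The range in the definition may be nonpositive; enlarging it is harmless. *)
Lemma finite_range_pos : exists2 r : R, 0 < r & finite_range Omega A r.
Proof.
have [r rangeA] := random_finite_range randomA.
exists (`|r| + 1); first by rewrite ltr_wpDl.
by apply: finite_range_mono rangeA; have := ler_norm r; lra.
Qed.

Lemma local_dos_bump_le (w : closed_set R d) (E c : R) : (0 < d)%N -> Omega w ->
  (forall f, ~ locally_supported_eigenfunction w (A w) E f) -> 0 < c ->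
  exists2 e : R, 0 < e & exists2 L : R, 0 < L &
    forall k, local_dos w (A w) (cube 0 (L * k.+1%:R)) (bump E e) <= c.
Proof.
move=> d0 Ow noeig c0; have [r r0 rangeA] := finite_range_pos.
have bA := random_bounded randomA; have sA := random_selfadjoint randomA.
have [sep sep0 sepw] := dds_separated ddsf Ow.
set h := sep / d.+1%:R; have h0 : 0 < h by rewrite divr_gt0.
pose m := (Num.truncn (r / h)).+1.
have rm : r <= h * m%:R.
  by rewrite -ler_pdivrMl// mulrC ltW// truncnS_gt.
(* Rim count over volume is at most [d * (2 * m) / (h ^+ d * N.+1)], independent of [k]; this [N]
   makes it at most [c]. *)
pose N := Num.truncn ((d * (2 * m))%:R / (c * h ^+ d)).
have chd : 0 < c * h ^+ d by rewrite mulr_gt0// exprn_gt0.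
have mN : (d * (2 * m))%:R <= c * h ^+ d * N.+1%:R.
  by rewrite -ler_pdivrMl// mulrC ltW// truncnS_gt.
have L0 : 0 < h * N.+1%:R by rewrite mulr_gt0.
have D0 : 0 < d%:R * (h * N.+1%:R) by rewrite mulr_gt0// ltr0n.
have [e0 e00 coer] := nsq_coercive ddsf bA r0 rangeA Ow D0 noeig.
(* [e <= 1] gives [e ^+ 2 <= e], and [e <= e0 / 2 < e0]. *)
pose e := Num.min 1 (e0 / 2).
have e_gt0 : 0 < e by rewrite lt_min ltr01 divr_gt0.
have ee0 : e ^+ 2 < e0.
  apply: (@le_lt_trans _ _ (e0 / 2)); last lra.
  apply: (@le_trans _ _ e); last by rewrite ge_min lexx orbT.
  by rewrite expr2 ler_piMr ?(ltW e_gt0)// ge_min lexx.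
exists e => //; exists (h * N.+1%:R) => // k.
have volE : volume (cube (0 : 'rV[R]_d) (h * N.+1%:R * k.+1%:R)) =
    h ^+ d * (k.+1 * N.+1)%:R ^+ d.
  rewrite volume_cube ?(mulr_ge0 (ltW L0))//.
  by rewrite -exprMn natrM; congr (_ ^+ _); ring.
have vol0 : 0 < volume (cube (0 : 'rV[R]_d) (h * N.+1%:R * k.+1%:R)).
  by rewrite volE mulr_gt0 ?exprn_gt0// ltr0n muln_gt0.
apply: le_trans (local_dos_le _ _ _ e_gt0 (ltW vol0)) _.
rewrite ler_pdivrMl// [leRHS]mulrC.
have := card_near_eigenvalues ddsf bA sA r0 rangeA Ow k sep0 sepw rm ee0 coer.
rewrite -(ler_nat R) => /le_trans; apply; rewrite volE.
have -> : (k.+1 * N.+1)%:R ^+ d = (k.+1 * N.+1)%:R * (k.+1 * N.+1)%:R ^+ d.-1 :> R.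
  by rewrite -exprS prednK.
have P0 : 0 <= (k.+1 * N.+1)%:R ^+ d.-1 :> R by rewrite exprn_ge0.
rewrite 2!natrM [X in _ * (_ * X)]natrX [(2 * m * k.+1)%:R]natrM mulrA mulrA -natrM.
rewrite [X in _ <= _ * (_ * (X * _))]natrM.
move: ((k.+1 * N.+1)%:R ^+ d.-1) P0 => P P0.
have -> : c * (h ^+ d * (k.+1%:R * N.+1%:R * P)) = c * h ^+ d * N.+1%:R * k.+1%:R * P.
  by ring.
by rewrite !ler_wpM2r.
Qed.

End Main.

(** The invariant measure gives [Omega] mass 1. A point of [Omega] is required both to pass from all
    to one and to compute the density of states. *)
Lemma uniquely_ergodic_nonempty (R : realType) (d : nat)
  (Omega : set (closed_set R d)) : uniquely_ergodic Omega -> Omega !=set0.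
Proof.
move=> [mu [muO _] _]; apply/set0P/eqP => O0; move: muO; rewrite O0 measure0.
by move=> /eqP; rewrite eqe => /eqP/esym/eqP; rewrite oner_eq0.
Qed.

Theorem theorem2 (R : realType) (d : nat) (d_gt0 : (0 < d)%N)
    (Omega : set (closed_set R d))
    (ddsf : is_ddsf Omega) (ergodic : strictly_ergodic Omega)
    (A : closed_set R d -> @operator R d)
    (randomA : selfadjoint_random_operator Omega A)
    (rho : {finite_measure set R -> \bar R})
    (ids : integrated_density_of_states Omega A rho) (E : R) :
  let discontinuity := ~ {for E, continuous (distribution_function rho)} in
  let one := exists w, Omega w /\
    exists f, locally_supported_eigenfunction w (A w) E f in
  let all := forall w, Omega w ->
    exists f, locally_supported_eigenfunction w (A w) E f in
  (discontinuity <-> one) /\ (one <-> all).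
Proof.
move=> discontinuity one all.
have [min erg] := ergodic; have [w0 Ow0] := uniquely_ergodic_nonempty erg.
have bA := random_bounded randomA; have sA := random_selfadjoint randomA.
have [r r0 rangeA] := finite_range_pos randomA.
have dos_cvg w e L : Omega w -> 0 < e -> 0 < L ->
    local_dos w (A w) (cube 0 (L * k.+1%:R)) (bump E e) @[k --> \oo] -->
    Rintegral rho setT (bump E e).
  move=> Ow e0 L0; apply: ids => //; first exact: van_hove_cube.
    exact: continuous_bump.
  by exists 1 => x; rewrite ger0_norm ?bump_ge0// bump_le1.
split; split.
- move=> disc; apply: contrapT => none; apply: disc; apply: continuous_of_bump => c c0.
  have [|e e0 [L L0 dosc]] := local_dos_bump_le ddsf randomA d_gt0 Ow0 (E := E) _ c0.
    by move=> f lf; apply: none; exists w0; split => //; exists f.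
  exists e => //; apply: cvgr_to_le (dos_cvg _ _ _ Ow0 e0 L0) _.
  by near=> k; exact: dosc.
- move=> [w [Ow [f lf]]].
  have [S S0 eig] := eigenfunction_repetitive ddsf bA r0 rangeA min Ow lf.
  have S1 : 0 < 2 * S + 1 by lra.
  apply: (@discontinuous_of_bump _ _ _ ((2 * S + 1) ^+ d)^-1) => [|e e0].
    by rewrite invr_gt0 exprn_gt0.
  apply: cvgr_to_ge (dos_cvg _ _ _ Ow e0 S1) _.
  by near=> k; exact: (local_dos_bump_ge ddsf bA sA k Ow S0 e0 eig).
- move=> [w [Ow [f lf]]] w' Ow'.
  exact: (eigenfunction_transfer ddsf bA r0 rangeA min Ow Ow' lf).
- by move=> eig; exists w0; split => //; exact: eig.
Unshelve. all: by end_near.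
Qed.
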